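(* Let $k\ge 2$. If the probabilities $\mathcal{P}=\{p_{i,j}\}$ on $[n]$ are weakly monotonic and form a bounded $k$-class, then the mixing time $\tau_{tk}$ of the transposition chain $\mathcal{M}_{tk}$ satisfies $\tau_{tk}(\epsilon)=O\big(n^{2k}\ln(k\epsilon^{-1})\big)$.
   Context: Let $\mathcal{P}=\{p_{i,j}:1\le i\ne j\le n\}$ with $p_{i,j}\in[0,1]$ and $p_{j,i}=1-p_{i,j}$; write $\lambda_{i,j}=p_{i,j}/p_{j,i}$. $\mathcal{P}$ is weakly monotonic if (1) $p_{i,j}\ge 1/2$ for all $2\le i<j\le n$, and either (2) $p_{i,j+1}\ge p_{i,j}$ for all $1\le i<j\le n-1$, or (3) $p_{i-1,j}\ge p_{i,j}$ for all $2\le i<j\le n$. $\mathcal{P}$ forms a $k$-class if $[n]$ is partitioned into consecutive intervals $C_1=\{1,\dots,d_1\}$, $C_2=\{d_1+1,\dots,d_2\}$, $\dots$, $C_k=\{d_{k-1}+1,\dots,n\}$ (for some $d_1<\dots<d_{k-1}$) such that $p_{x,y}=1/2$ whenever $x,y$ lie in the same class, and for all $1\le i<j\le k$, $x_1,x_2\in C_i$, $y\in C_j$ we have $p_{x_1,y}=p_{x_2,y}$. Write $C(x)=i$ iff $x\in C_i$. The $k$-class is bounded if there is a constant $\gamma>1$ with $p_{i,j}/p_{j,i}\ge\gamma$ for all $1\le i<j\le n$ with $C(i)\ne C(j)$. The chain $\mathcal{M}_{tk}$ on the set $S_n$ of permutations $\sigma=(\sigma(1),\dots,\sigma(n))$ of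 $[n]$: from $\sigma_t$, choose a position $1\le i\le n$ and a direction $d\in\{L,R,N\}$ uniformly at random. If $d=L$: find the largest $j<i$ with $C(\sigma_t(j))\ge C(\sigma_t(i))$ (if one exists); if $C(\sigma_t(j))>C(\sigma_t(i))$, exchange $\sigma_t(i)$ and $\sigma_t(j)$. If $d=R$: find the smallest $j>i$ with $C(\sigma_t(j))\ge C(\sigma_t(i))$ (if one exists); if $C(\sigma_t(j))>C(\sigma_t(i))$, then with probability $\lambda_{\sigma_t(j),\sigma_t(i)}\prod_{i<m<j}\lambda_{\sigma_t(j),\sigma_t(m)}\lambda_{\sigma_t(m),\sigma_t(i)}$ exchange $\sigma_t(i)$ and $\sigma_t(j)$. If $d=N$: find the largest $j<i$ with $C(\sigma_t(j))=C(\sigma_t(i))$; if it exists, exchange $\sigma_t(i)$ and $\sigma_t(j)$. Otherwise $\sigma_{t+1}=\sigma_t$. Its stationary distribution is $\pi(\sigma)\propto\prod_{i<j}p_{\sigma(i),\sigma(j)}$. The mixing time of a chain with transition matrix $P$ and stationary distribution $\pi$ is $\tau(\epsilon)=\min\{t:\max_{x}\tfrac12\sum_y|P^{t'}(x,y)-\pi(y)|\le\epsilon\ \forall t'\ge t\}$.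
   Formalization: In a k-class, p_{x,y} is required to depend only on the classes of both x and y (otherwise π is not stationary), and the exchange probabilities of M_tk are assumed to be at most 1 (automatic under (2), can fail under (3), where the chain would not exist). *)

(* Defs.v *)
(* MathComp / MathComp-Analysis. *)
From mathcomp Require Import all_boot all_order all_algebra all_fingroup.
From mathcomp Require Import constructive_ereal reals exp.

Set Implicit Arguments.
Unset Strict Implicit.
Unset Printing Implicit Defensive.

Import Order.TTheory GRing.Theory Num.Theory.
Local Open Scope ring_scope.

(* The ground set [n] is 'I_n, so the element (or position) x of {1, ..., n} is
   the ordinal of value x - 1; classes 1, ..., k are likewise 'I_k. *)

Section Probabilities.
Context {R : realType} {n : nat}.
Implicit Type p : 'I_n -> 'I_n -> R.

(* The diagonal values p x x are junk: nothing below constrains or uses them. *)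
Definition pair_probabilities p :=
  forall i j : 'I_n, i != j -> 0 <= p i j <= 1 /\ p j i = 1 - p i j.

(* lambda_{i,j} is extended-real valued because p j i = 0 is allowed: there
   lambda_{i,j} = 1 / 0 = +oo. Products use the convention 0 * +oo = 0. *)
Definition lambda p (i j : 'I_n) : \bar R := ((p i j)%:E / (p j i)%:E)%E.

(* The lower bound 2 <= i on indices of [n] reads 1 <= i for ordinals. *)
Definition half_bounded p :=
  forall i j : 'I_n, (1 <= i)%N -> (i < j)%N -> 2^-1 <= p i j.

Definition row_monotone p :=
  forall i j j' : 'I_n, (i < j)%N -> j' = j.+1 :> nat -> p i j <= p i j'.

Definition col_monotone p :=
  forall i' i j : 'I_n, i = i'.+1 :> nat -> (i < j)%N -> p i j <= p i' j.

Definition weakly_monotonic p :=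
  half_bounded p /\ (row_monotone p \/ col_monotone p).

End Probabilities.

Section Classes.
Context {R : realType} {n k : nat}.
Implicit Types (p : 'I_n -> 'I_n -> R) (C : 'I_n -> 'I_k).

(* C sends x to the index of its class, the classes being delimited by the cut
   points 0 = d_0 < d_1 < ... < d_k = n: the ordinals d_c <= x < d_(c+1) stand
   for the elements d_c + 1, ..., d_(c+1) of [n]. *)
Definition interval_classes (d : nat -> nat) C :=
  [/\ d 0%N = 0%N, d k = n,
      forall c, (c < k)%N -> (d c < d c.+1)%N
    & forall (x : 'I_n) (c : 'I_k), C x = c <-> (d c <= x < d c.+1)%N].

(* Constancy is required for C x1 smaller and for C x1 larger than C y, so that
   p x y depends only on the two classes. With the case C x1 < C y only, p could
   vary with y inside a class, and exchanging two elements of one class would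
   not preserve the distribution pi below. *)
Definition k_class p C :=
  [/\ exists d, interval_classes d C,
      forall x y : 'I_n, x != y -> C x = C y -> p x y = 2^-1
    & forall x1 x2 y : 'I_n, C x1 = C x2 -> C x1 != C y -> p x1 y = p x2 y].

Definition bounded_k_class (gamma : R) p C :=
  k_class p C /\
  forall i j : 'I_n, (i < j)%N -> C i != C j -> (gamma%:E <= lambda p i j)%E.

End Classes.

Section FiniteChains.
Context {R : realType} {S : finType}.
Implicit Types (P : S -> S -> R) (pi : S -> R).

Fixpoint iter_kernel P (t : nat) (x y : S) : R :=
  if t is t'.+1 then \sum_z P x z * iter_kernel P t' z y else (x == y)%:R.

Definition tv_dist (mu nu : S -> R) : R := 2^-1 * \sum_y `|mu y - nu y|.

Definition worst_tv P pi (t : nat) : R :=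
  \big[Num.max/0]_x tv_dist (iter_kernel P t x) pi.

Definition mixed P pi (eps : R) (t : nat) :=
  forall t', (t <= t')%N -> worst_tv P pi t' <= eps.

Definition is_mixing_time P pi eps (tau : nat) :=
  mixed P pi eps tau /\ forall t, mixed P pi eps t -> (tau <= t)%N.

End FiniteChains.

Definition last_before {n} (Q : pred 'I_n) (i : 'I_n) : option 'I_n :=
  [pick j : 'I_n | [&& (j < i)%N, Q j &
     [forall m : 'I_n, (j < m < i)%N ==> ~~ Q m]]].

Definition first_after {n} (Q : pred 'I_n) (i : 'I_n) : option 'I_n :=
  [pick j : 'I_n | [&& (i < j)%N, Q j &
     [forall m : 'I_n, (i < m < j)%N ==> ~~ Q m]]].

Variant direction := DirL | DirR | DirN.

Section TranspositionChain.
Context {R : realType} {n k : nat}.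
Implicit Types (p : 'I_n -> 'I_n -> R) (C : 'I_n -> 'I_k) (s : 'S_n).

(* s i is the element at position i; perm composition is left to right, so
   exchange s i j swaps the contents of positions i and j. *)
Definition exchange s (i j : 'I_n) : 'S_n := (tperm i j * s)%g.

Definition left_partner C s (i : 'I_n) :=
  last_before (fun j => (C (s i) <= C (s j))%N) i.

Definition right_partner C s (i : 'I_n) :=
  first_after (fun j => (C (s i) <= C (s j))%N) i.

Definition same_partner C s (i : 'I_n) :=
  last_before (fun j => C (s j) == C (s i)) i.

Definition right_accept p s (i j : 'I_n) : \bar R :=
  (lambda p (s j) (s i) *
   \prod_(m < n | (i < m < j)%N) (lambda p (s j) (s m) * lambda p (s m) (s i)))%E.

(* The number [right_accept] is a probability whenever the rule uses it, so that
   the chain exists. This always holds under [row_monotone] (see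
   [row_monotone_tk_well_defined]) but can fail under [col_monotone]:
   with singleton classes, p_{1,2} = 99/100 and p_{1,3} = p_{2,3} = 6/10,
   exchanging 2 and 3 in (2,1,3) would have probability 44. *)
Definition tk_well_defined p C :=
  forall (s : 'S_n) (i j : 'I_n), right_partner C s i = Some j ->
    (C (s i) < C (s j))%N -> (right_accept p s i j <= 1)%E.

(* Law of the next state when an exchange of positions i and j is accepted with
   probability a. *)
Definition propose (a : R) s (i j : 'I_n) (s' : 'S_n) : R :=
  a * (s' == exchange s i j)%:R + (1 - a) * (s' == s)%:R.

Definition tk_move p C s (i : 'I_n) (d : direction) (s' : 'S_n) : R :=
  match d with
  | DirL =>
      if left_partner C s i is Some j then
        if (C (s i) < C (s j))%N then propose 1 s i j s' else (s' == s)%:R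
      else (s' == s)%:R
  | DirR =>
      if right_partner C s i is Some j then
        if (C (s i) < C (s j))%N then propose (fine (right_accept p s i j)) s i j s'
        else (s' == s)%:R
      else (s' == s)%:R
  | DirN =>
      if same_partner C s i is Some j then propose 1 s i j s' else (s' == s)%:R
  end.

Definition tk_kernel p C (s s' : 'S_n) : R :=
  (n * 3)%:R^-1 * \sum_(i < n)
    (tk_move p C s i DirL s' + tk_move p C s i DirR s' + tk_move p C s i DirN s').

Definition perm_weight p (s : 'S_n) : R :=
  \prod_(i < n) \prod_(j < n | (i < j)%N) p (s i) (s j).

Definition perm_pi p (s : 'S_n) : R :=
  perm_weight p s / \sum_(s' : 'S_n) perm_weight p s'.

End TranspositionChain.

Section WellDefined.
Context {R : realType} {n k : nat}.
Context (p : 'I_n -> 'I_n -> R) (C : 'I_n -> 'I_k).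

Lemma interval_classes_lt d (x y : 'I_n) :
  interval_classes d C -> (C x < C y)%N -> (x < y)%N.
Proof.
move=> [_ _ dS dC] Cxy; have /andP[_ xlt] := (dC x (C x)).1 erefl.
have /andP[ley _] := (dC y (C y)).1 erefl.
apply: leq_trans xlt (leq_trans _ ley).
suff dle : forall b, (C x < b)%N -> (b <= k)%N -> (d (C x).+1 <= d b)%N.
  exact: dle Cxy (ltnW (ltn_ord _)).
elim=> // b IHb; rewrite ltnS leq_eqVlt => /orP[/eqP->//|xb] bk.
exact: leq_trans (IHb xb (ltnW bk)) (ltnW (dS _ bk)).
Qed.

Lemma row_monotone_le (i j j' : 'I_n) :
  row_monotone p -> (i < j)%N -> (j <= j')%N -> p i j <= p i j'.
Proof.
move=> mono ij; case: j' => m mn /=; elim: m mn => [|m IHm] mn.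
  by rewrite leqn0 => /eqP j0; rewrite j0 in ij.
rewrite leq_eqVlt => /orP[/eqP jm|]; first by rewrite (_ : Ordinal mn = j) //; apply: val_inj.
rewrite ltnS => jm; apply: le_trans (IHm (ltnW mn) jm) _.
by apply: mono => //=; apply: leq_trans ij jm.
Qed.

Lemma row_monotone_tk_well_defined (gamma : R) :
  1 < gamma -> pair_probabilities p -> bounded_k_class gamma p C ->
  row_monotone p -> tk_well_defined p C.
Proof.
move=> g1 pP [[[d dC] _ _] bd] mono s i j.
rewrite /right_partner /first_after; case: pickP => //= j0 /and3P[ij _ /forallP bet] [<-{j}] Cij.
have sij := interval_classes_lt dC Cij.
have lam_ge0 x y : x != y -> (0 <= lambda p x y)%E.
  move=> xy; have [/andP[p0 p1] pE] := pP _ _ xy.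
  apply: mule_ge0; first by rewrite lee_fin.
  by rewrite inve_ge0 lee_fin pE subr_ge0.
have half (x y : 'I_n) : (x < y)%N -> C x != C y -> p y x < p x y.
  move=> xy Cxy; have xNy : x != y by rewrite neq_ltn xy.
  have [/andP[p0 p1] pE] := pP _ _ xNy.
  have yx0 : 0 <= p y x by rewrite pE subr_ge0.
  have [yx|yx] := eqVneq (p y x) 0.
    by rewrite yx; move: pE; rewrite yx => /eqP; rewrite eq_sym subr_eq0 => /eqP<-.
  have {}yx : 0 < p y x by rewrite lt_neqAle eq_sym yx.
  have := bd _ _ xy Cxy; rewrite /lambda inver gt_eqF// -EFinM lee_fin ler_pdivlMr// => gp.
  by apply: lt_le_trans gp; rewrite ltr_pMl.
have lam_le1 (x y : 'I_n) : (x < y)%N -> C x != C y -> (lambda p y x <= 1)%E.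
  move=> xy Cxy; have lt := half _ _ xy Cxy.
  have xNy : y != x by rewrite neq_ltn xy orbT.
  have [/andP[p0 p1] pE] := pP _ _ xNy.
  have xy0 : 0 < p x y by apply: le_lt_trans lt.
  by rewrite /lambda inver gt_eqF// -EFinM lee_fin ler_pdivrMr// mul1r ltW.
have mule_le1 (u v : \bar R) : (0 <= v -> u <= 1 -> v <= 1 -> u * v <= 1)%E.
  move=> v0 u1 v1; apply: le_trans v1.
  by rewrite -[leRHS]mul1e; apply: lee_wpmul2r.
rewrite /right_accept; have /andP[q0 q1] :
  (0 <= \prod_(m < n | (i < m < j0)%N)
     (lambda p (s j0) (s m) * lambda p (s m) (s i)) <= 1)%E; last first.
  by apply: mule_le1 => //; apply: lam_le1 => //; rewrite neq_ltn Cij.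
apply: (big_ind (fun x => 0 <= x <= 1)%E) => //.
- by rewrite lexx lee01.
- move=> x y /andP[x0 x1] /andP[y0 y1].
  by rewrite mule_ge0//= mule_le1.
move=> m imj; have /andP[im mj] := imj.
have {}/implyP := bet m => /(_ imj); rewrite -ltnNge => Cmi.
have smi := interval_classes_lt dC Cmi.
apply/andP; split.
  by apply: mule_ge0; apply: lam_ge0; rewrite (inj_eq perm_inj) neq_ltn ?im ?mj ?orbT.
set a := s i; set b := s j0; set c := s m; rewrite -/a -/b -/c in sij smi Cij Cmi.
have cb : (c < b)%N := ltn_trans smi sij.
have le := row_monotone_le mono smi (ltnW sij).
have ltca := half _ _ smi _; have {ltca} : p a c < p c a by apply: ltca; rewrite neq_ltn Cmi.
have ltcb := half _ _ cb _; have {ltcb} : p b c < p c b by apply: ltcb; rewrite neq_ltn (ltn_trans Cmi Cij).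
have [|/andP[ca0 ca1] pac] := pP c a _; first by rewrite neq_ltn smi.
have [|/andP[cb0 cb1] pbc] := pP c b _; first by rewrite neq_ltn cb.
rewrite pac pbc => cbh cah.
have cbp : 0 < p c b by apply: le_lt_trans cbh; rewrite subr_ge0.
have cap : 0 < p c a by apply: le_lt_trans cah; rewrite subr_ge0.
have [ca1e|ca1n] := eqVneq (p c a) 1.
  have cb1e : p c b = 1 by apply/eqP; rewrite eq_le cb1 -ca1e.
  by rewrite {1}/lambda pbc cb1e subrr !mul0e lee01.
have ac0 : 0 < 1 - p c a by rewrite subr_gt0 lt_neqAle ca1n.
rewrite /lambda pac pbc !inver !gt_eqF// -!EFinM lee_fin.
rewrite mulrACA -invfM ler_pdivrMr ?mulr_gt0// mul1r.
by rewrite mulrBl mulrBr mul1r mulr1 lerBlDr subrK.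
Qed.

End WellDefined.

(* Main.v *)
Require Import Defs.
From mathcomp Require Import all_boot all_order all_algebra all_fingroup.
From mathcomp Require Import constructive_ereal reals exp.
From mathcomp Require Import sequences.
From mathcomp Require Import zify ring lra.

(** The left and right moves act on the word of classes and keep the order of the
    elements inside each class; the moves inside a class act on that order
    only, and independently of the word. So two mixing statements suffice.

    Order inside the classes. Let F be the difference of P^t f between a state and
    the state with the labels a, b of one class exchanged. F changes sign under
    this exchange, hence the move exchanging a and b when they are neighbours
    cancels against the idle move of the first element of the class, and
    P contracts F, weighted by a concave function of the rank distance of a and b,
    by 1 - 4/(3 n^3). A relabelling is a product of at most n transpositions.

    Word. Only two properties of the rates are used: a right move is accepted
    with probability at most 1, and at most 1/gamma if it jumps over nothing.
    A right move that jumps over smaller elements is charged to the left move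
    available to the first of them. This gives, by induction on the classes, a
    potential bounded by O(n^2) with drift at most -c off the set O of the
    class-sorted states and O(1) on O. Stationarity then bounds pi(O) from below by
    a constant, and O is hit within O(n^3) steps. By reversibility P^{2t}(x, O) >=
    pi(O) for x in O, so that after O(n^3) steps every state is in O with
    probability bounded below, which contracts oscillations. *)

Set Implicit Arguments.
Unset Strict Implicit.
Unset Printing Implicit Defensive.

Import Order.TTheory GRing.Theory Num.Theory.
Local Open Scope ring_scope.

(** * Averaging operators of finite reversible chains *)

(** The class-sorted states form a single orbit of the relabellings that preserve classes, and this
    joins the two halves of the proof. These relabellings commute with the chain, so the probability
    of being in O at time t is the same from every point of O, and a return estimate averaged over O
    holds at each point. Moreover the values of P^t f on O differ only through the order inside the
    classes. Two independent copies that are both in O can therefore be compared by the label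
    estimate, and the word has only to reach O; no coupling of words is constructed.

    Some p may be 0, so pi may vanish at some states. Hence no estimate divides by the mass of a
    single state, and the Lyapunov bound holds from every starting state.

    All constants depend on gamma and k only. Blocks of O(n^3) steps contract oscillations by a
    constant factor, and O(ln(1/eps)) blocks are used. The label error needs a further time of order
    n^3 (ln n + ln(1/eps)); the crude bound ln n <= n turns this into n^4, which is at most n^(2k)
    because k >= 2. *)

Section AveragingOperator.
Context {R : realType} {S : finType}.
Variables (P : S -> S -> R).
Implicit Types (f g pi : S -> R) (x y z : S) (t : nat).

Definition stochastic := (forall x y, 0 <= P x y) /\ forall x, \sum_y P x y = 1.

Definition avg f x : R := \sum_y P x y * f y.

Lemma iter_kernelE t f x :
  \sum_y iter_kernel P t x y * f y = iter t avg f x.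
Proof.
elim: t x => [|t IHt] x /=.
  rewrite (bigD1 x)//= eqxx mul1r big1 ?addr0// => y.
  by rewrite eq_sym => /negPf->; rewrite mul0r.
under eq_bigr do rewrite mulr_suml.
rewrite exchange_big /=; apply: eq_bigr => z _.
by rewrite -IHt mulr_sumr; apply: eq_bigr => y _; rewrite mulrA.
Qed.

Lemma avgD f g x : avg (fun y => f y + g y) x = avg f x + avg g x.
Proof. by rewrite /avg -big_split; apply: eq_bigr => y _; rewrite mulrDr. Qed.

Lemma avgZ c f x : avg (fun y => c * f y) x = c * avg f x.
Proof. by rewrite /avg mulr_sumr; apply: eq_bigr => y _; rewrite mulrCA. Qed.

Lemma eq_avg f g : f =1 g -> avg f =1 avg g.
Proof. by move=> fg x; apply: eq_bigr => y _; rewrite fg. Qed.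

Lemma eq_iter_avg t f g : f =1 g -> iter t avg f =1 iter t avg g.
Proof. by move=> fg; elim: t => //= t IHt; apply: eq_avg. Qed.

Lemma iter_avgD t f g x :
  iter t avg (fun y => f y + g y) x = iter t avg f x + iter t avg g x.
Proof. by elim: t x => //= t IHt x; rewrite (eq_avg IHt) avgD. Qed.

Lemma iter_avgZ t c f x : iter t avg (fun y => c * f y) x = c * iter t avg f x.
Proof. by elim: t x => //= t IHt x; rewrite (eq_avg IHt) avgZ. Qed.

Hypothesis stochP : stochastic.

Lemma avg_cst c x : avg (fun=> c) x = c.
Proof. by rewrite /avg -mulr_suml stochP.2 mul1r. Qed.

Lemma iter_avg_cst t c x : iter t avg (fun=> c) x = c.
Proof. by elim: t x => //= t IHt x; rewrite (eq_avg IHt) avg_cst. Qed.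

Lemma ler_avg f g : (forall x, f x <= g x) -> forall x, avg f x <= avg g x.
Proof. by move=> fg x; apply: ler_sum => y _; rewrite ler_wpM2l// stochP.1. Qed.

Lemma ler_iter_avg t f g :
  (forall x, f x <= g x) -> forall x, iter t avg f x <= iter t avg g x.
Proof. by move=> fg; elim: t => //= t IHt; apply: ler_avg. Qed.

Lemma iter_avg_bounds t f :
  (forall x, 0 <= f x <= 1) -> forall x, 0 <= iter t avg f x <= 1.
Proof.
move=> f01 x; apply/andP; split.
  rewrite -(iter_avg_cst t 0 x); apply: ler_iter_avg => y.
  by case/andP: (f01 y).
rewrite -[leRHS](iter_avg_cst t 1 x); apply: ler_iter_avg => y.
by case/andP: (f01 y).
Qed.

Lemma iter_avg_affine t a b f x :
  iter t avg (fun y => a + b * f y) x = a + b * iter t avg f x.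
Proof. by rewrite (iter_avgD t (fun=> a)) iter_avg_cst iter_avgZ. Qed.

Section Stationary.
Variable pi : S -> R.
Hypotheses (pi_ge0 : forall x, 0 <= pi x) (pi_sum1 : \sum_x pi x = 1).
Hypothesis reversible : forall x y, pi x * P x y = pi y * P y x.

Lemma avg_selfadjoint f g :
  \sum_x pi x * (avg f x * g x) = \sum_x pi x * (f x * avg g x).
Proof.
rewrite (eq_bigr (fun x => \sum_y pi x * P x y * (f y * g x))); last first.
  by move=> x _; rewrite mulr_suml mulr_sumr; apply: eq_bigr => y _; ring.
rewrite exchange_big; apply: eq_bigr => y _ /=.
rewrite !mulr_sumr; apply: eq_bigr => x _; rewrite reversible; ring.
Qed.

Lemma iter_avg_selfadjoint t f g :
  \sum_x pi x * (iter t avg f x * g x) = \sum_x pi x * (f x * iter t avg g x).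
Proof.
elim: t f g => // t IHt f g; rewrite iterS avg_selfadjoint IHt.
by apply: eq_bigr => x _; rewrite -iterSr.
Qed.

Lemma iter_avg_stationary t f :
  \sum_x pi x * iter t avg f x = \sum_x pi x * f x.
Proof.
have := iter_avg_selfadjoint t f (fun=> 1).
under eq_bigr do rewrite mulr1; move=> ->.
by apply: eq_bigr => x _; rewrite iter_avg_cst mulr1.
Qed.

(** The total variation distance is attained at the indicator of the states where P^t(x, .) exceeds
    pi. By stationarity the mean of this f under pi is that of P^t f, so the distance is a
    pi-average of differences of P^t f. *)
Lemma tv_dist_le t x a :
  (forall f, (forall x, 0 <= f x <= 1) ->
     forall x y, iter t avg f x - iter t avg f y <= a) ->
  tv_dist (iter_kernel P t x) pi <= a.
Proof.
move=> osc; pose K := iter_kernel P t x.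
have sumK : \sum_y K y = 1.
  have := iter_kernelE t (fun=> 1) x; rewrite iter_avg_cst => <-.
  by apply: eq_bigr => y _; rewrite mulr1.
pose f y : R := (pi y < K y)%R%:R.
have f01 y : 0 <= f y <= 1 by rewrite /f; case: (_ < _)%R; rewrite /= lexx ler01.
have normE y : `|K y - pi y| = 2 * ((K y - pi y) * f y) - (K y - pi y).
  rewrite /f; have [lt|le] := ltP (pi y) (K y).
    by rewrite gtr0_norm ?subr_gt0//=; ring.
  by rewrite ler0_norm ?subr_le0//=; ring.
rewrite /tv_dist -/K (eq_bigr _ (fun y _ => normE y)) sumrB -mulr_sumr.
rewrite [X in _ - X]sumrB sumK pi_sum1 subrr subr0 mulKf ?pnatr_eq0//.
under eq_bigr do rewrite mulrBl.
rewrite sumrB iter_kernelE -(iter_avg_stationary t f).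
rewrite -[X in X - _]mul1r -pi_sum1 mulr_suml -sumrB.
rewrite -[leRHS]mul1r -pi_sum1 mulr_suml; apply: ler_sum => y _.
by rewrite -mulrBr ler_wpM2l// osc.
Qed.

(* Cauchy-Schwarz for P^t 1_O, which has pi-mean pi(O). *)
Lemma return_mass_ge (O : {set S}) t :
  (\sum_(x in O) pi x) ^+ 2 <=
  \sum_(x in O) pi x * iter (t + t) avg (fun x => (x \in O)%:R) x.
Proof.
set h := fun x => (x \in O)%:R; set m := \sum_(x in O) pi x.
have mE : \sum_x pi x * h x = m.
  by rewrite /m [RHS]big_mkcond; apply: eq_bigr => x _; rewrite /h; case: ifP => _ /=; ring.
have -> : \sum_(x in O) pi x * iter (t + t) avg h x =
    \sum_x pi x * (iter t avg h x * iter t avg h x).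
  rewrite iter_avg_selfadjoint [LHS]big_mkcond; apply: eq_bigr => x _.
  by rewrite -iterD /h; case: ifP => _ /=; ring.
have : 0 <= \sum_x pi x * (iter t avg h x - m) ^+ 2.
  by apply: sumr_ge0 => x _; rewrite mulr_ge0// sqr_ge0.
rewrite (eq_bigr (fun x => pi x * (iter t avg h x * iter t avg h x)
    - 2 * m * (pi x * iter t avg h x) + m ^+ 2 * pi x)); last first.
  by move=> x _; ring.
rewrite big_split sumrB -!mulr_sumr /= pi_sum1 iter_avg_stationary mE.
set u := \sum_x _; lra.
Qed.

End Stationary.

Section Hitting.
Variable O : {set S}.

Definition occupation t x : R := iter t avg (fun y => (y \in O)%:R) x.

(** Probability of avoiding [O] at all the times 0, ..., t: an iterate of the chain killed on
    [O]. *)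
Definition survival t x : R :=
  iter t (fun f y => (y \notin O)%:R * avg f y) (fun y => (y \notin O)%:R) x.

Lemma survival_bounds t x : 0 <= survival t x <= 1.
Proof.
elim: t x => [|t IHt] x; rewrite /survival /=.
  by case: (x \notin O); rewrite /= lexx ler01.
have := iter_avg_bounds 1 IHt x; rewrite /= /survival.
by case: (x \notin O); rewrite ?mul1r// mul0r lexx ler01.
Qed.

Lemma survival_antitone t x : survival t.+1 x <= survival t x.
Proof.
elim: t x => [|t IHt] x; last first.
  by rewrite /survival /=; apply: ler_wpM2l => //; apply: ler_avg => y; apply: IHt.
have := iter_avg_bounds 1 (survival_bounds 0) x; rewrite /survival /=.
by case: (x \notin O) => /andP[_ le1]; rewrite ?mul1r// !mul0r.
Qed.

(** The drift bounds the expected time before [O] by V / d. That time is a sum of survival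
    probabilities, each of the first t being at least [survival t]. *)
Lemma survival_lyapunov (V : S -> R) d :
  (forall x, 0 <= V x) -> (forall x, x \notin O -> avg V x + d <= V x) -> 0 <= d ->
  forall t x, d * t%:R * survival t x <= V x.
Proof.
move=> V0 drift d0 t x.
have sum_le u y : d * \sum_(v < u) survival v y <= V y.
  elim: u y => [|u IHu] y; first by rewrite big_ord0 mulr0.
  have [yO|yO] := boolP (y \in O).
    rewrite big1 ?mulr0// => v _.
    by case: v => [[|v] vu]; rewrite /survival /= yO// mul0r.
  apply: le_trans (drift _ yO); rewrite big_ord_recl /= addrC mulrDr lerD//; last first.
    by rewrite /survival /= yO mulr1.
  under eq_bigr do rewrite /survival /= yO mul1r.
  have -> : \sum_(v < u) avg (survival v) y = avg (fun z => \sum_(v < u) survival v z) y.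
    rewrite /avg exchange_big /=; apply: eq_bigr => z _; by rewrite mulr_sumr.
  by rewrite -avgZ; apply: ler_avg.
apply: le_trans (sum_le t x); rewrite -mulrA ler_wpM2l//.
rewrite mulr_natl -[in X in _ *+ X](card_ord t) -sumr_const; apply: ler_sum => v _.
have : (v <= t)%N by exact: ltnW.
elim: t {v} (v : nat) => [|t IHt] v; first by rewrite leqn0 => /eqP->.
rewrite leq_eqVlt => /orP[/eqP->//|]; rewrite ltnS => /IHt.
exact: le_trans (survival_antitone _ _).
Qed.

(** Decomposition at the first visit to [O]: from there on [O] is occupied with probability at least
    kappa, however much time is left. *)
Lemma occupation_ge kappa t x :
  0 <= kappa -> (forall u o, o \in O -> kappa <= occupation u o) ->
  kappa * (1 - survival t x) <= occupation t x.
Proof.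
move=> k0 kO; elim: t x => [|t IHt] x; have [xO|xO] := boolP (x \in O).
- by rewrite (_ : survival 0 x = 0) ?subr0 ?mulr1 ?kO// /survival /= xO.
- by rewrite (_ : survival 0 x = 1) ?subrr ?mulr0 ?ler0n// /survival /= xO.
- by rewrite (_ : survival t.+1 x = 0) ?subr0 ?mulr1 ?kO// /survival /= xO mul0r.
have -> : survival t.+1 x = avg (survival t) x by rewrite /survival /= xO mul1r.
rewrite mulrBr mulr1.
have := ler_avg IHt x; apply: le_trans.
rewrite [leRHS](eq_avg (g := fun y => kappa + (- kappa) * survival t y)); last by move=> y; ring.
by rewrite (avgD (fun=> kappa)) avg_cst avgZ mulNr.
Qed.

(** Two independent copies started at x and y are both in [O] at time t with probability at least
    e^2. Then f differs by at most d, and otherwise by at most w. *)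
Lemma iter_avg_contraction t e w d f :
  0 <= e -> 0 <= w -> (forall x, e <= occupation t x) ->
  (forall x y, f x - f y <= w) ->
  (forall x y, x \in O -> y \in O -> f x - f y <= d) -> 0 <= d ->
  forall x y, iter t avg f x - iter t avg f y <= (1 - e ^+ 2) * w + d.
Proof.
move=> e0 w0 eO fw fd d0 x y; pose h z : R := (z \in O)%:R.
(* This form is affine in [h z] and in [h z'] separately, so averaging over each copy in turn
   replaces the indicators by occupation probabilities. *)
have pair z z' : f z <= (f z' + w + d) + (- w * h z') * h z.
  have := fw z z'; rewrite /h.
  have [zO|zO] := boolP (z \in O); last by rewrite /= mulr0; lra.
  have [z'O|z'O] := boolP (z' \in O); last by rewrite /= mulr0 mul0r; lra.
  by have := fd _ _ zO z'O; rewrite /= !mulr1; lra.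
have one z' : iter t avg f x - w - d + (w * occupation t x) * h z' <= f z'.
  have := ler_iter_avg t (pair^~ z') x; rewrite iter_avg_affine -/(occupation t x).
  set a := iter _ _ f x; nra.
have := ler_iter_avg t one y; rewrite iter_avg_affine -/(occupation t y).
have : e ^+ 2 <= occupation t x * occupation t y.
  by rewrite expr2 ler_pM.
set a := iter _ _ f x; set b := iter _ _ f y; nra.
Qed.

End Hitting.
End AveragingOperator.

(** * Moves of the transposition chain *)

Section NearestPosition.
Context {n : nat}.
Implicit Types (Q : pred 'I_n) (i j : 'I_n).

Lemma last_beforeP Q i j :
  last_before Q i = Some j <->
  [/\ (j < i)%N, Q j & forall m : 'I_n, (j < m < i)%N -> ~~ Q m].
Proof.
rewrite /last_before; case: pickP => [j0 /and3P[ji Qj /forallP bet]|none]; split=> //.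
- by case=> <-; split=> // m jmi; have /implyP := bet m; apply.
- move=> [j1i Qj1 bet1]; congr Some; apply: val_inj => /=.
  have [lt|lt|//] := ltngtP j0 j.
    by have /implyP := bet j; rewrite lt j1i Qj1 => /(_ isT).
  by have := bet1 j0; rewrite lt ji Qj => /(_ isT).
- move=> [ji Qj bet]; have := none j; rewrite ji Qj /=.
  by case/negP; apply/forallP => m; apply/implyP/bet.
Qed.

Lemma first_afterP Q i j :
  first_after Q i = Some j <->
  [/\ (i < j)%N, Q j & forall m : 'I_n, (i < m < j)%N -> ~~ Q m].
Proof.
rewrite /first_after; case: pickP => [j0 /and3P[ji Qj /forallP bet]|none]; split=> //.
- by case=> <-; split=> // m jmi; have /implyP := bet m; apply.
- move=> [j1i Qj1 bet1]; congr Some; apply: val_inj => /=.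
  have [lt|lt|//] := ltngtP j0 j.
    by have := bet1 j0; rewrite lt ji Qj => /(_ isT).
  by have /implyP := bet j; rewrite lt j1i Qj1 => /(_ isT).
- move=> [ji Qj bet]; have := none j; rewrite ji Qj /=.
  by case/negP; apply/forallP => m; apply/implyP/bet.
Qed.

Lemma last_before_ex Q i j :
  (j < i)%N -> Q j -> exists j', last_before Q i = Some j'.
Proof.
move=> ji Qj; case: (@arg_maxnP _ j (fun j => (j < i)%N && Q j) val) => [|j' /andP[j'i Qj'] mx].
  by rewrite ji.
exists j'; apply/last_beforeP; split=> // m /andP[jm mi]; apply/negP => Qm.
by have := mx m; rewrite mi Qm => /(_ isT); rewrite /= leqNgt jm.
Qed.

End NearestPosition.

Section Moves.
Context {R : realType} {n k : nat}.
Variables (p : 'I_n -> 'I_n -> R) (C : 'I_n -> 'I_k).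
Implicit Types (s : 'S_n) (i j m x y : 'I_n) (f : 'S_n -> R).

Definition lmove s i : option 'I_n :=
  if left_partner C s i is Some j then if (C (s i) < C (s j))%N then Some j else None
  else None.

Definition rmove s i : option 'I_n :=
  if right_partner C s i is Some j then if (C (s i) < C (s j))%N then Some j else None
  else None.

Definition accept s i j : R := fine (right_accept p s i j).

Lemma lmoveP s i j : lmove s i = Some j <->
  [/\ (j < i)%N, (C (s i) < C (s j))%N &
      forall m, (j < m < i)%N -> (C (s m) < C (s i))%N].
Proof.
rewrite /lmove; split.
  case E: left_partner => [j'|//]; case: ifP => // lt [<-].
  by have /last_beforeP[ji _ bet] := E; split=> // m /bet; rewrite -ltnNge.
move=> [ji lt bet]; rewrite (_ : left_partner C s i = Some j) ?lt//.
by apply/last_beforeP; split=> //; [exact: ltnW | move=> m /bet; rewrite -ltnNge].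
Qed.

Lemma rmoveP s i j : rmove s i = Some j <->
  [/\ (i < j)%N, (C (s i) < C (s j))%N &
      forall m, (i < m < j)%N -> (C (s m) < C (s i))%N].
Proof.
rewrite /rmove; split.
  case E: right_partner => [j'|//]; case: ifP => // lt [<-].
  by have /first_afterP[ji _ bet] := E; split=> // m /bet; rewrite -ltnNge.
move=> [ji lt bet]; rewrite (_ : right_partner C s i = Some j) ?lt//.
by apply/first_afterP; split=> //; [exact: ltnW | move=> m /bet; rewrite -ltnNge].
Qed.

Lemma same_partnerP s i j : same_partner C s i = Some j <->
  [/\ (j < i)%N, C (s j) = C (s i) &
      forall m, (j < m < i)%N -> C (s m) <> C (s i)].
Proof.
split=> [/last_beforeP[ji /eqP Cj bet]|[ji Cj bet]].
  by split=> // m /bet/eqP.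
by apply/last_beforeP; split=> //; [exact/eqP | move=> m /bet/eqP].
Qed.

Lemma exchangeK s i j : exchange (exchange s i j) j i = s.
Proof. by rewrite /exchange mulgA tpermC tperm2 mul1g. Qed.

Lemma exchangeE s i j x : exchange s i j x = s (tperm i j x).
Proof. by rewrite /exchange permM. Qed.

Lemma exchange_swap s i j :
  (exchange s i j i = s j) * (exchange s i j j = s i).
Proof. by rewrite !exchangeE tpermL tpermR. Qed.

Lemma exchange_id s i j x : x != i -> x != j -> exchange s i j x = s x.
Proof. by move=> xi xj; rewrite exchangeE tpermD// eq_sym. Qed.

(** The elements jumped over are smaller in class than the element that moves, so they block neither
    the move nor the move back. *)
Lemma lmove_rmove s i j :
  lmove s i = Some j <-> rmove (exchange s i j) j = Some i.
Proof.
split=> [/lmoveP[ji lt bet]|/rmoveP[ji lt bet]].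
  apply/rmoveP; rewrite !exchange_swap; split=> // m /[dup]/andP[jm mi] /bet.
  by rewrite exchange_id// neq_ltn ?mi ?jm ?orbT.
move: lt bet; rewrite !exchange_swap => lt bet.
apply/lmoveP; split=> // m /[dup]/andP[jm mi] /bet.
by rewrite exchange_id// neq_ltn ?mi ?jm ?orbT.
Qed.

Lemma rmove_lmove s i j :
  rmove s i = Some j <-> lmove (exchange s i j) j = Some i.
Proof. by rewrite lmove_rmove exchangeK. Qed.

Lemma same_partner_class s i j x :
  same_partner C s i = Some j -> C (exchange s i j x) = C (s x).
Proof.
move=> /same_partnerP[_ Cj _]; rewrite exchangeE.
by case: tpermP => [->|->|].
Qed.


Definition jumpL f s i : R :=
  if lmove s i is Some j then f (exchange s i j) - f s else 0.
Definition jumpR f s i : R :=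
  if rmove s i is Some j then accept s i j * (f (exchange s i j) - f s) else 0.
Definition jumpN f s i : R :=
  if same_partner C s i is Some j then f (exchange s i j) - f s else 0.

(* [3 n (P - 1)], so that every single move has rate one. *)
Definition gen f s : R := \sum_i (jumpL f s i + jumpR f s i + jumpN f s i).

Lemma sum_propose a s i j f :
  \sum_s' propose a s i j s' * f s' = f s + a * (f (exchange s i j) - f s).
Proof.
have pick s0 : \sum_s' (s' == s0)%:R * f s' = f s0.
  rewrite (bigD1 s0)//= eqxx mul1r big1 ?addr0// => s' /negPf->.
  by rewrite mul0r.
rewrite /propose; under eq_bigr do rewrite mulrDl -!mulrA.
by rewrite big_split -!mulr_sumr !pick /=; ring.
Qed.

Lemma avg_tk f s : (0 < n)%N ->
  avg (tk_kernel p C) f s = f s + (n * 3)%:R^-1 * gen f s.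
Proof.
move=> n0.
have stay : \sum_(s' : 'S_n) (s' == s)%:R * f s' = f s.
  rewrite (bigD1 s)//= eqxx mul1r big1 ?addr0// => s' /negPf->.
  by rewrite mul0r.
have avgL i : \sum_s' tk_move p C s i DirL s' * f s' = f s + jumpL f s i.
  rewrite /jumpL /lmove /=; case: left_partner => [j|]; rewrite ?stay ?addr0//.
  by case: ifP => _; rewrite ?stay ?addr0// sum_propose mul1r.
have avgR i : \sum_s' tk_move p C s i DirR s' * f s' = f s + jumpR f s i.
  rewrite /jumpR /rmove /=; case: right_partner => [j|]; rewrite ?stay ?addr0//.
  by case: ifP => _; rewrite ?stay ?addr0// sum_propose.
have avgN i : \sum_s' tk_move p C s i DirN s' * f s' = f s + jumpN f s i.
  rewrite /jumpN /=; case: same_partner => [j|]; rewrite ?stay ?addr0//.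
  by rewrite sum_propose mul1r.
have -> : avg (tk_kernel p C) f s =
    (n * 3)%:R^-1 * \sum_i (f s + f s + f s + (jumpL f s i + jumpR f s i + jumpN f s i)).
  rewrite /avg /tk_kernel; under eq_bigr do rewrite -mulrA mulr_suml.
  rewrite -mulr_sumr exchange_big; congr (_ * _); apply: eq_bigr => i _ /=.
  under eq_bigr do rewrite !mulrDl.
  by rewrite !big_split avgL avgR avgN /=; ring.
rewrite big_split mulrDr -/(gen f s); congr (_ + _).
rewrite sumr_const card_ord -[f s + f s + f s](_ : 3 * f s = _); last by ring.
rewrite -[_ *+ n]mulr_natl natrM.
by field; rewrite ?pnatr_eq0 -?lt0n n0.
Qed.

End Moves.

(** * Products of extended-real odds, and the effect of a swap on ordered products *)

Section ErealProducts.
Context {R : realType}.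

(* [x] is the extended-real value of [a / b]. A product of such values can be
   finite although a denominator vanishes, since [0 * +oo = 0]; then a numerator
   vanishes as well. *)
Definition is_ratio (x : \bar R) (a b : R) :=
  [/\ (0 <= x)%E, x = +oo%E -> b = 0 & x != +oo%E -> a = b * fine x].

Lemma is_ratio1 : is_ratio 1%E 1 1.
Proof. by split=> //=; rewrite ?mulr1// lee01. Qed.

Lemma is_ratioM x a b x' a' b' :
  is_ratio x a b -> is_ratio x' a' b' -> is_ratio (x * x')%E (a * a') (b * b').
Proof.
move=> [x0 xy xf] [x'0 x'y x'f]; split; first exact: mule_ge0.
  case: x x' x0 x'0 xy x'y {xf x'f} => [r||] [r'||]//= x0 x'0 xy x'y.
  - by move=> _; rewrite x'y// mulr0.
  - by move=> _; rewrite xy// mul0r.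
  - by move=> _; rewrite xy// mul0r.
case: x x' x0 x'0 xy x'y xf x'f => [r||] [r'||]//= x0 x'0 xy x'y xf x'f.
- by move=> _; rewrite xf// x'f//; ring.
(* A finite factor times an infinite one: if r = 0 both sides vanish, otherwise the product is
   infinite and nothing is claimed. *)
- rewrite xf// x'y//; have [->|r0] := eqVneq r 0; first by rewrite mul0e mulr0 !mul0r.
  by rewrite gt0_muley ?lte_fin ?eqxx// lt_neqAle eq_sym r0 -lee_fin.
- rewrite x'f// xy//; have [->|r0] := eqVneq r' 0; first by rewrite mule0 !mulr0.
  by rewrite gt0_mulye ?lte_fin ?eqxx// lt_neqAle eq_sym r0 -lee_fin.
Qed.

Lemma is_ratio_prod (I : Type) (r : seq I) (Q : pred I) (x : I -> \bar R) (a b : I -> R) :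
  (forall i, Q i -> is_ratio (x i) (a i) (b i)) ->
  is_ratio (\prod_(i <- r | Q i) x i)%E (\prod_(i <- r | Q i) a i) (\prod_(i <- r | Q i) b i).
Proof.
move=> h; elim/big_rec3: _ => [|i c b' a' Qi h']; first exact: is_ratio1.
by apply: is_ratioM => //; apply: h.
Qed.

End ErealProducts.

Section Swap.
Context {R : comNzRingType} {n : nat}.
Implicit Types (i j m x y : 'I_n).

Lemma prod_crossing (P : 'I_n -> 'I_n -> R) i j : (j < i)%N ->
  \prod_(x < n) \prod_(y < n | (x < y)%N && ~~ (tperm i j x < tperm i j y)%N) P x y =
  P j i * \prod_(m < n | (j < m < i)%N) (P j m * P m i).
Proof.
move=> ji; have iNj : i != j by rewrite neq_ltn ji orbT.
have cross x y : (x < y)%N && ~~ (tperm i j x < tperm i j y)%N =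
    (x == j) && (y == i) || (x == j) && (j < y < i)%N || (j < x < i)%N && (y == i).
  case: (tpermP i j x) => [->|->|/eqP + /eqP +]; case: (tpermP i j y) => [->|->|/eqP + /eqP +];
    rewrite -!val_eqE /=; move: (ji); lia.
rewrite (bigD1 j)//= big_split /= mulrA; congr (_ * _).
  rewrite (bigD1 i)/=; last by rewrite cross !eqxx.
  congr (_ * _); apply: eq_bigl => y; rewrite cross -!val_eqE /=; move: (ji); lia.
rewrite (bigID (fun x => j < x < i)%N) /= [X in _ * X]big1 ?mulr1; last first.
  move=> x /andP[xj xji]; rewrite big_pred0// => y; rewrite cross.
  by rewrite (negPf xj) (negPf xji).
rewrite [LHS](eq_bigl (fun x => j < x < i)%N); last first.
  by move=> x; rewrite -!val_eqE /=; move: (ji); lia.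
apply: eq_bigr => x xji; rewrite (big_pred1 i)// => y; rewrite cross xji /=.
by have /negPf-> : x != j by move: xji; rewrite -val_eqE /=; lia.
Qed.

(* Exchanging the contents of [j < i] only reverses the pairs in [[j, i]] that
   involve [i] or [j]. *)
Lemma prod_ordered_swap (P : 'I_n -> 'I_n -> R) i j : (j < i)%N ->
  exists W : R,
    \prod_(x < n) \prod_(y < n | (x < y)%N) P x y =
      W * (P j i * \prod_(m < n | (j < m < i)%N) (P j m * P m i)) /\
    \prod_(x < n) \prod_(y < n | (x < y)%N) P (tperm i j x) (tperm i j y) =
      W * (P i j * \prod_(m < n | (j < m < i)%N) (P m j * P i m)).
Proof.
move=> ji; set t := tperm i j.
(* [W] collects the pairs whose order survives the transposition. *)
exists (\prod_(x < n) \prod_(y < n | (x < y)%N && (t x < t y)%N) P x y); split.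
  rewrite -(prod_crossing P ji) -big_split; apply: eq_bigr => x _ /=.
  by rewrite (bigID (fun y => t x < t y)%N).
have -> : \prod_(x < n) \prod_(y < n | (x < y)%N) P (t x) (t y) =
          \prod_(x < n) \prod_(y < n | (t x < t y)%N) P x y.
  rewrite [RHS](reindex_inj (@perm_inj _ t)); apply: eq_bigr => x _.
  rewrite [RHS](reindex_inj (@perm_inj _ t)); apply: eq_bigl => y /=.
  by rewrite !tpermK.
rewrite -(prod_crossing (fun x y => P y x) ji) [X in _ = _ * X](exchange_big_dep predT)//=.
rewrite -big_split; apply: eq_bigr => x _ /=.
rewrite (bigID (fun y => x < y)%N) /=; congr (_ * _).
  by apply: eq_bigl => y; rewrite andbC.
apply: eq_bigl => y; rewrite -!leqNgt -/t andbC.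
have [->|xy] := eqVneq x y; first by rewrite !ltnn ?andbF.
have txy : val (t x) != val (t y) by rewrite val_eqE (inj_eq perm_inj).
move: xy txy; rewrite -!val_eqE /=; lia.
Qed.

End Swap.

(** * Reversibility *)

Section ChainFacts.
Context {R : realType} {n k : nat}.
Variables (gamma : R) (p : 'I_n -> 'I_n -> R) (C : 'I_n -> 'I_k).
Hypotheses (gamma_gt1 : 1 < gamma) (pP : pair_probabilities p).
Hypotheses (pC : bounded_k_class gamma p C) (wd : tk_well_defined p C).
Implicit Types (s g : 'S_n) (i j m x y : 'I_n) (f : 'S_n -> R).

Lemma class_ltW x y : (C x < C y)%N -> (x < y)%N.
Proof. by case: pC => -[[d dC] _ _] _; apply: interval_classes_lt dC. Qed.

Lemma pair_ge0 x y : x != y -> 0 <= p x y.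
Proof. by move=> xy; have [/andP[]] := pP xy. Qed.

Lemma pair_compl x y : x != y -> p y x = 1 - p x y.
Proof. by move=> xy; have [_] := pP xy. Qed.

Lemma class_ltN x y : (C x < C y)%N -> x != y.
Proof. by move=> /class_ltW; rewrite neq_ltn => ->. Qed.

Lemma lambda_is_ratio x y : x != y -> is_ratio (lambda p x y) (p x y) (p y x).
Proof.
move=> xy; have p0 := pair_ge0 xy.
have q0 : 0 <= p y x by apply: pair_ge0; rewrite eq_sym.
split; first by rewrite /lambda mule_ge0 ?inve_ge0 ?lee_fin.
  by rewrite /lambda inver; case: eqP => // _; rewrite -EFinM.
rewrite /lambda inver; have [yx0|yx0] := eqVneq (p y x) 0; last first.
  by rewrite -EFinM /= mulrC divfK.
have -> : p x y = 1.
  by move: (pair_compl xy); rewrite yx0 => /eqP; rewrite eq_sym subr_eq0 => /eqP.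
by rewrite mul1e.
Qed.

(** Multiplied out, because [p y x] may be 0 and [lambda] infinite. *)
Lemma pair_lt x y : (C x < C y)%N -> gamma * p y x <= p x y /\ 0 < p x y.
Proof.
move=> Cxy; have xy := class_ltN Cxy.
have [_ bd] := pC; have := bd _ _ (class_ltW Cxy).
rewrite -val_eqE /= neq_ltn Cxy => /(_ isT).
have [/andP[p0 p1] pE] := pP xy.
rewrite /lambda inver; case: eqP => [yx0|/eqP yx0 gp].
  rewrite yx0 mulr0 => _; split=> //.
  by move: pE; rewrite yx0 => /eqP; rewrite eq_sym subr_eq0 => /eqP <-.
have q0 : 0 < p y x by rewrite lt_neqAle eq_sym yx0 pE subr_ge0.
move: gp; rewrite -EFinM lee_fin ler_pdivlMr// => gp; split=> //.
by apply: lt_le_trans gp; rewrite mulr_gt0// (lt_trans ltr01).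
Qed.

(** Constancy in the first argument is part of [k_class]; taking complements transfers it to the
    second. *)
Lemma eq_class_pair x y x' y' : x != y -> x' != y' ->
  C x = C x' -> C y = C y' -> p x y = p x' y'.
Proof.
case: pC => -[_ half cst] _ xy xy' Cx Cy.
have [Cxy|Cxy] := eqVneq (C x) (C y).
  by rewrite !half// -Cx -Cy.
have x'y : x' != y by apply: contraNneq Cxy => <-; rewrite Cx.
rewrite (cst x x' y)// (pair_compl (x := y) (y := x')) 1?eq_sym//.
rewrite (cst y y' x')//; last by rewrite -Cx eq_sym.
by rewrite -pair_compl// eq_sym.
Qed.

Section SameWord.
Variables (s s' : 'S_n).
Hypothesis eqC : forall x, C (s' x) = C (s x).

Lemma eq_class_lmove i : lmove C s' i = lmove C s i.
Proof.
have iffE j : lmove C s' i = Some j <-> lmove C s i = Some j.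
  rewrite !lmoveP !eqC; split=> -[ji lt bet]; split=> // m /bet; by rewrite eqC.
case E: (lmove C s' i) => [j|]; first by rewrite (iffE j).1.
by case E' : (lmove C s i) => [j|//]; rewrite (iffE j).2 in E.
Qed.

Lemma eq_class_rmove i : rmove C s' i = rmove C s i.
Proof.
have iffE j : rmove C s' i = Some j <-> rmove C s i = Some j.
  rewrite !rmoveP !eqC; split=> -[ji lt bet]; split=> // m /bet; by rewrite eqC.
case E: (rmove C s' i) => [j|]; first by rewrite (iffE j).1.
by case E' : (rmove C s i) => [j|//]; rewrite (iffE j).2 in E.
Qed.

Lemma eq_class_same_partner i : same_partner C s' i = same_partner C s i.
Proof.
have iffE j : same_partner C s' i = Some j <-> same_partner C s i = Some j.
  rewrite !same_partnerP !eqC; split=> -[ji lt bet]; split=> // m /bet; by rewrite eqC.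
case E: (same_partner C s' i) => [j|]; first by rewrite (iffE j).1.
by case E' : (same_partner C s i) => [j|//]; rewrite (iffE j).2 in E.
Qed.

Lemma eq_class_accept i j : i != j -> accept p s' i j = accept p s i j.
Proof.
move=> ij; have lamE x y : x != y -> lambda p (s' x) (s' y) = lambda p (s x) (s y).
  move=> xy; rewrite /lambda; congr (_%:E / _%:E)%E;
    by apply: eq_class_pair; rewrite ?(inj_eq perm_inj)// eq_sym.
rewrite /accept /right_accept lamE 1?eq_sym//; congr (fine (_ * _)%E).
apply: eq_bigr => m /andP[im mj].
by rewrite !lamE// neq_ltn ?im ?mj ?orbT.
Qed.

End SameWord.

(** Moves and rates see only the word of classes, so relabelling inside the classes is a symmetry of
    the chain. *)
Lemma gen_relabel g f s : (forall x, C (g x) = C x) ->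
  gen p C (fun s => f (s * g)%g) s = gen p C f (s * g)%g.
Proof.
move=> gC; have eqC x : C ((s * g)%g x) = C (s x) by rewrite permM gC.
have exM i j : exchange (s * g)%g i j = (exchange s i j * g)%g.
  by rewrite /exchange mulgA.
apply: eq_bigr => i _; rewrite /jumpL /jumpR /jumpN.
rewrite (eq_class_lmove eqC) (eq_class_rmove eqC) (eq_class_same_partner eqC).
congr (_ + _ + _).
- by case: lmove => [j|//]; rewrite exM.
- case E: rmove => [j|//]; have /rmoveP[ij _ _] := E.
  by rewrite exM (eq_class_accept eqC)// neq_ltn ij.
- by case: same_partner => [j|//]; rewrite exM.
Qed.

Lemma right_accept_is_ratio s i j : (i < j)%N ->
  is_ratio (right_accept p s i j)
    (p (s j) (s i) * \prod_(m < n | (i < m < j)%N) (p (s j) (s m) * p (s m) (s i)))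
    (p (s i) (s j) * \prod_(m < n | (i < m < j)%N) (p (s m) (s j) * p (s i) (s m))).
Proof.
move=> ij; apply: is_ratioM.
  by apply: lambda_is_ratio; rewrite (inj_eq perm_inj) neq_ltn ij orbT.
apply: is_ratio_prod => m /andP[im mj].
apply: is_ratioM; apply: lambda_is_ratio; by rewrite (inj_eq perm_inj) neq_ltn ?im ?mj ?orbT.
Qed.

Lemma right_accept_le1 s i j : rmove C s i = Some j -> (right_accept p s i j <= 1)%E.
Proof.
rewrite /rmove; case E: right_partner => [j'|//]; case: ifP => // lt [<-].
exact: wd.
Qed.

Lemma accept_bounds s i j : rmove C s i = Some j -> 0 <= accept p s i j <= 1.
Proof.
move=> mv; have /rmoveP[ij _ _] := mv.
have := right_accept_le1 mv; have [] := right_accept_is_ratio s ij.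
by rewrite /accept; case: right_accept => [r||]//=; rewrite !lee_fin => -> _ _ ->.
Qed.

(** With nothing jumped over, only one factor [lambda] is left. This is how the bias gamma enters
    the rates; longer jumps are only known to have rate at most 1. *)
Lemma accept_adjacent s i j : rmove C s i = Some j ->
  (forall m, ~~ (i < m < j)%N) -> accept p s i j <= gamma^-1.
Proof.
move=> mv none; have /rmoveP[ij lt _] := mv.
rewrite /accept /right_accept big_pred0 ?mule1; last by move=> m; apply/negbTE.
have [gp p0] := pair_lt lt.
rewrite /lambda inver gt_eqF// -EFinM /= ler_pdivrMr// mulrC.
by rewrite ler_pdivlMr ?(lt_trans ltr01)// mulrC.
Qed.

Lemma perm_weight_exchange s i j : (j < i)%N ->
  exists W, perm_weight p s =
      W * (p (s j) (s i) * \prod_(m < n | (j < m < i)%N) (p (s j) (s m) * p (s m) (s i))) /\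
    perm_weight p (exchange s i j) =
      W * (p (s i) (s j) * \prod_(m < n | (j < m < i)%N) (p (s m) (s j) * p (s i) (s m))).
Proof.
move=> ji; have [W [Ws Ws']] := prod_ordered_swap (fun x y => p (s x) (s y)) ji.
exists W; split; first exact: Ws.
rewrite -Ws' /perm_weight; apply: eq_bigr => x _; apply: eq_bigr => y _.
by rewrite !exchangeE.
Qed.

Lemma perm_weight_lmove s i j : lmove C s i = Some j ->
  perm_weight p s = perm_weight p (exchange s i j) * accept p (exchange s i j) j i.
Proof.
move=> mv; have /lmoveP[ji lt bet] := mv.
have [W [-> ->]] := perm_weight_exchange s ji; rewrite -mulrA; congr (_ * _).
have mv' := (lmove_rmove C s i j).1 mv.
have := right_accept_le1 mv'; have [_ _] := right_accept_is_ratio (exchange s i j) ji.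
rewrite /accept !exchange_swap => fin acc1.
(* Finiteness is what turns [is_ratio] into an equation valid even when the weights vanish. *)
have {}acc1 : right_accept p (exchange s i j) j i != +oo%E.
  by apply: contraTneq acc1 => ->.
move: (fin acc1); rewrite (eq_bigr (fun m => p (s j) (s m) * p (s m) (s i))); last first.
  by move=> m /andP[jm mi]; rewrite !exchange_id ?neq_ltn ?jm ?mi ?orbT.
move=> ->; congr (_ * _ * _); apply: eq_bigr => m /andP[jm mi].
by rewrite !exchange_id ?neq_ltn ?jm ?mi ?orbT.
Qed.

Lemma eq_class_perm_weight s s' : (forall x, C (s' x) = C (s x)) ->
  perm_weight p s' = perm_weight p s.
Proof.
move=> eqC; apply: eq_bigr => x _; apply: eq_bigr => y xy.
by apply: eq_class_pair => //; rewrite (inj_eq perm_inj) neq_ltn xy.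
Qed.

Lemma tk_kernel_ge0 s s' : 0 <= tk_kernel p C s s'.
Proof.
have propose_ge0 a i j : 0 <= a <= 1 -> 0 <= propose a s i j s'.
  move=> /andP[a0 a1]; rewrite /propose addr_ge0// mulr_ge0 ?subr_ge0//.
rewrite /tk_kernel mulr_ge0 ?invr_ge0//; apply: sumr_ge0 => i _.
rewrite /tk_move; apply: addr_ge0; first apply: addr_ge0.
- case: left_partner => [j|//]; case: ifP => // _; apply: propose_ge0.
  by rewrite ler01 lexx.
- case E: right_partner => [j|//]; case: ifP => // lt; apply: propose_ge0.
  by apply: accept_bounds; rewrite /rmove E lt.
- case: same_partner => [j|//]; apply: propose_ge0; by rewrite ler01 lexx.
Qed.

Hypothesis n_gt0 : (0 < n)%N.

Lemma tk_stochastic : stochastic (tk_kernel p C).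
Proof.
split=> [s s'|s]; first exact: tk_kernel_ge0.
have := avg_tk p C (fun=> 1) s n_gt0.
rewrite /avg; under eq_bigr do rewrite mulr1; move=> ->.
rewrite /gen big1 ?mulr0 ?addr0// => i _; rewrite /jumpL /jumpR /jumpN.
by case: lmove => [?|]; case: rmove => [?|]; case: same_partner => [?|];
  rewrite ?subrr ?mulr0 ?addr0.
Qed.

(** The double sum over positions lets the reversibility proof exchange the roles of i and j. *)
Lemma tk_kernel_neq s s' : s' != s ->
  tk_kernel p C s s' = (n * 3)%:R^-1 * \sum_(i < n) \sum_(j < n)
    ((lmove C s i == Some j)%:R + (rmove C s i == Some j)%:R * accept p s i j
      + (same_partner C s i == Some j)%:R) * (s' == exchange s i j)%:R.
Proof.
move=> /negPf ss'; rewrite /tk_kernel; congr (_ * _); apply: eq_bigr => i _.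
have sumO (o : option 'I_n) (F : 'I_n -> R) :
    \sum_j (o == Some j)%:R * F j = if o is Some j then F j else 0.
  case: o => [j|]; last by rewrite big1// => j _; rewrite mul0r.
  rewrite (bigD1 j)//= eqxx mul1r big1 ?addr0// => j' /negPf jj'.
  by rewrite -[_ == _](_ : (j' == j) = _) ?jj' ?mul0r// eq_sym.
under eq_bigr do rewrite !mulrDl -mulrA.
rewrite !big_split /= !sumO /tk_move /lmove /rmove /propose ss'.
congr (_ + _ + _).
- by case: left_partner => // j; case: ifP => // _; rewrite mulr0 mul1r addr0.
- by case: right_partner => // j; case: ifP => // _; rewrite mulr0 addr0.
- by case: same_partner => // j; rewrite mulr0 mul1r addr0.
Qed.

(** A left move at (i, j) is balanced by the right move back at (j, i) ([TE]); a move inside a class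
    is balanced by itself ([NE]). *)
Lemma tk_reversible s s' :
  perm_pi p s * tk_kernel p C s s' = perm_pi p s' * tk_kernel p C s' s.
Proof.
rewrite /perm_pi ![_ / _ * _]mulrAC; congr (_ / _).
have [->//|ss'] := eqVneq s' s.
have s's : s != s' by rewrite eq_sym.
rewrite (tk_kernel_neq ss') (tk_kernel_neq s's) [LHS]mulrCA [RHS]mulrCA; congr (_ * _).
rewrite !mulr_sumr.
under eq_bigr do rewrite mulr_sumr; under [RHS]eq_bigr do rewrite mulr_sumr.
pose T (b : bool) s s' i j : R := perm_weight p s *
  ((if b then (lmove C s i == Some j)%:R else (rmove C s i == Some j)%:R * accept p s i j)
    * (s' == exchange s i j)%:R).
pose N s s' i j : R := perm_weight p s *
  ((same_partner C s i == Some j)%:R * (s' == exchange s i j)%:R).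
have split3 s1 s2 : \sum_i \sum_j perm_weight p s1 *
    (((lmove C s1 i == Some j)%:R + (rmove C s1 i == Some j)%:R * accept p s1 i j
      + (same_partner C s1 i == Some j)%:R) * (s2 == exchange s1 i j)%:R) =
    \sum_i \sum_j T true s1 s2 i j + \sum_i \sum_j T false s1 s2 i j
      + \sum_i \sum_j N s1 s2 i j.
  rewrite -!big_split; apply: eq_bigr => i _; rewrite -!big_split.
  by apply: eq_bigr => j _; rewrite /T /N /=; ring.
have exE s1 s2 i j : (s2 == exchange s1 i j) = (s1 == exchange s2 j i).
  by apply/eqP/eqP => ->; rewrite exchangeK.
have TE s1 s2 i j : T true s1 s2 i j = T false s2 s1 j i.
  rewrite /T exE; have [->|_] := eqVneq s1 (exchange s2 j i); last by rewrite /= !mulr0.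
  rewrite !mulr1.
  have [/eqP mv|mv] := boolP (lmove C (exchange s2 j i) i == Some j).
    rewrite (perm_weight_lmove mv) exchangeK.
    by rewrite ((rmove_lmove C s2 j i).2 mv) eqxx /= mul1r mulr1.
  suff /negPf-> : rmove C s2 j != Some i by rewrite /= !mul0r !mulr0.
  by apply: contraNneq mv => /rmove_lmove/eqP.
(* Partners and weights depend only on the word, which such a move preserves, so the same pair (i,
   j) leads back. *)
have NE s1 s2 i j : N s1 s2 i j = N s2 s1 i j.
  have exC s3 : exchange s3 i j = exchange s3 j i by rewrite /exchange tpermC.
  have half s3 s4 : same_partner C s3 i = Some j -> s4 = exchange s3 i j ->
      N s3 s4 i j = N s4 s3 i j.
    move=> mv s4E; have eqC x : C (s4 x) = C (s3 x).
      by rewrite s4E; apply: same_partner_class mv.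
    rewrite /N (eq_class_same_partner eqC) (eq_class_perm_weight eqC).
    by rewrite exE exC.
  have [/andP[/eqP mv /eqP s2E]|not12] :=
    boolP ((same_partner C s1 i == Some j) && (s2 == exchange s1 i j)); first exact: half.
  have [/andP[/eqP mv /eqP s2E]|not21] :=
    boolP ((same_partner C s2 i == Some j) && (s1 == exchange s2 i j)); first by rewrite (half s2).
  by rewrite /N -!natrM !mulnb (negPf not12) (negPf not21) /= !mulr0.
rewrite !split3 [X in _ + _ + X](eq_bigr _ (fun i _ => eq_bigr _ (fun j _ => NE s s' i j))).
congr (_ + _); rewrite addrC; congr (_ + _).
  rewrite exchange_big; apply: eq_bigr => i _; apply: eq_bigr => j _; by rewrite TE.
rewrite exchange_big; apply: eq_bigr => i _; apply: eq_bigr => j _; by rewrite TE.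
Qed.

Lemma perm_weight_ge0 s : 0 <= perm_weight p s.
Proof.
apply: prodr_ge0 => x _; apply: prodr_ge0 => y xy.
by apply: pair_ge0; rewrite (inj_eq perm_inj) neq_ltn xy.
Qed.

(** Other weights may be 0; the identity has all its factors positive and makes the normalisation of
    pi legitimate. *)
Lemma perm_weight1_gt0 : 0 < perm_weight p 1%g.
Proof.
apply: prodr_gt0 => x _; apply: prodr_gt0 => y xy; rewrite !perm1.
have [Cxy|Cxy|Cxy] := ltngtP (C x) (C y).
- by have [] := pair_lt Cxy.
- by have := class_ltW Cxy; rewrite ltnNge ltnW.
- case: pC => -[_ half _] _; rewrite half ?invr_gt0// ?neq_ltn ?xy//.
  exact: val_inj.
Qed.

Lemma perm_weight_sum_gt0 : 0 < \sum_s perm_weight p s.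
Proof.
rewrite (bigD1 1%g)//= ltr_pwDl ?perm_weight1_gt0//.
by apply: sumr_ge0 => s _; apply: perm_weight_ge0.
Qed.

Lemma perm_pi_ge0 s : 0 <= perm_pi p s.
Proof. by rewrite divr_ge0 ?perm_weight_ge0// ltW// perm_weight_sum_gt0. Qed.

Lemma perm_pi_sum1 : \sum_s perm_pi p s = 1.
Proof. by rewrite -mulr_suml divff// gt_eqF// perm_weight_sum_gt0. Qed.

End ChainFacts.

(** * Young diagrams of the classes *)

Section ClassPotentials.
Context {R : realType} {n k : nat}.
Variables (p : 'I_n -> 'I_n -> R) (C : 'I_n -> 'I_k).
Implicit Types (s : 'S_n) (i j m x y z u : 'I_n) (c : nat) (U : nat -> nat -> R).

Definition bigger_before c s y : nat := \sum_(x < n) ((x < y) && (c < C (s x)))%N.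

Definition equal_after c s y : nat := \sum_(x < n) ((y < x) && (C (s x) == c :> nat))%N.

(* Reading the elements of class c and those of larger classes as a lattice
   path, [bigger_before] and [equal_after] are the row length and the row index
   of the Young diagram under the path. *)
Definition potential c U s : R :=
  \sum_(y | C (s y) == c :> nat) U (bigger_before c s y) (equal_after c s y).

Lemma tperm_order i j x y : (j < i)%N -> ~~ (j < x < i)%N -> ~~ (j < y < i)%N ->
  ~~ ((x == i) && (y == j)) -> ~~ ((x == j) && (y == i)) ->
  (tperm i j x < tperm i j y)%N = (x < y)%N.
Proof.
by case: (tpermP i j x) => [->|->|/eqP + /eqP +];
  case: (tpermP i j y) => [->|->|/eqP + /eqP +]; rewrite -!val_eqE /=; lia.
Qed.

Section LeftMove.
Variables (s : 'S_n) (i j : 'I_n).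
Hypothesis mv : lmove C s i = Some j.
Let t := tperm i j.
Let s' := exchange s i j.

Let ltji : (j < i)%N. Proof. by have /lmoveP[] := mv. Qed.
Let ltC : (C (s i) < C (s j))%N. Proof. by have /lmoveP[] := mv. Qed.

Lemma lmove_outside x : (C (s i) <= C (s x))%N -> ~~ (j < x < i)%N.
Proof.
by move=> le; apply/negP => /(let: And3 _ _ bet := (lmoveP C s i j).1 mv in bet x);
  rewrite ltnNge le.
Qed.

Let s'E x : s' (t x) = s x. Proof. by rewrite /s' exchangeE tpermK. Qed.

Lemma sum_exchange (F : 'I_n -> 'I_n -> nat) :
  (\sum_(x < n) F x (s' x) = \sum_(x < n) F (t x) (s x))%N.
Proof. by rewrite (reindex_inj (@perm_inj _ t)); apply: eq_bigr => x _; rewrite s'E. Qed.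

(** A left move keeps the order inside each class: elements of class at least [C (s i)] never lie
    strictly between the two positions, and those of smaller class stay where they are. *)
Lemma equal_after_lmove c y : C (s y) = c :> nat ->
  equal_after c s' (t y) = equal_after c s y.
Proof.
move=> Cy; rewrite /equal_after.
rewrite (sum_exchange (fun x z => nat_of_bool ((t y < x) && (C z == c :> nat))%N)).
apply: eq_bigr => x _; congr nat_of_bool; have [Cx|//] := eqVneq (nat_of_ord (C (s x))) c; last by rewrite !andbF.
rewrite !andbT; have [le|lt] := leqP (C (s i)) c.
  apply: tperm_order => //; try by apply: lmove_outside; rewrite ?Cx ?Cy.
    by apply/negP => /andP[/eqP yi /eqP xj]; move: ltC; rewrite -yi -xj Cx Cy ltnn.
  by apply/negP => /andP[/eqP yj /eqP xi]; move: ltC; rewrite -yj -xi Cx Cy ltnn.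
have fixt z : C (s z) = c :> nat -> t z = z.
  move=> Cz; rewrite /t tpermD//; apply/eqP => E; move: lt ltC; rewrite E Cz; lia.
by rewrite !fixt.
Qed.

Lemma bigger_before_lmove c y : C (s y) = c :> nat -> (C (s i) <= c)%N -> y != i ->
  bigger_before c s' (t y) = bigger_before c s y.
Proof.
move=> Cy le yi; rewrite /bigger_before.
rewrite (sum_exchange (fun x z => nat_of_bool ((x < t y) && (c < C z))%N)).
apply: eq_bigr => x _; congr nat_of_bool; have [Cx|//] := ltnP c (C (s x)); last by rewrite !andbF.
rewrite !andbT; apply: tperm_order => //; try by apply: lmove_outside; lia.
  by apply/negP => /andP[/eqP xi _]; move: Cx; rewrite xi; lia.
by rewrite (negPf yi) andbF.
Qed.

Lemma bigger_before_lmove_self :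
  bigger_before (C (s i)) s i = (bigger_before (C (s i)) s' j).+1.
Proof.
rewrite /bigger_before.
rewrite (sum_exchange (fun x z => nat_of_bool ((x < j) && (C (s i) < C z))%N)).
rewrite (bigD1 j)//= ltji ltC add1n; congr _.+1.
rewrite [RHS](bigD1 j)//= {1}/t tpermR (ltnNge i j) ltnW//=.
apply: eq_bigr => x xj; congr nat_of_bool.
have [Cx|//] := ltnP (C (s i)) (C (s x)); last by rewrite !andbF.
rewrite !andbT -[in RHS](tpermL i j) tperm_order//.
- by apply: lmove_outside; apply: ltnW.
- by rewrite ltnn andbF.
- by apply/negP => /andP[/eqP xi _]; move: Cx; rewrite xi ltnn.
- by rewrite (negPf xj).
Qed.

Lemma class_exchange_below c : (c < C (s i))%N ->
  forall x, ((c < C (s' x))%N = (c < C (s x))%N) * ((C (s' x) == c :> nat) = (C (s x) == c :> nat)).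
Proof.
move=> lt x; rewrite /s' exchangeE.
case: tpermP => [->|->|//]; move: ltC; split; lia.
Qed.

(** A left move removes one cell from the diagram of the class of [s i]. For smaller c both
    exchanged elements count as larger than c; for larger c nothing relevant is passed. *)
Lemma potential_lmove c U : potential c U s' = potential c U s +
  (if C (s i) == c :> nat then U (bigger_before c s i).-1 (equal_after c s i)
                     - U (bigger_before c s i) (equal_after c s i) else 0).
Proof.
have [lt|le] := ltnP c (C (s i)).
  have -> : (C (s i) == c :> nat) = false by move: lt; lia.
  have E := class_exchange_below lt.
  rewrite addr0 /potential (eq_bigl _ _ (fun y => (E y).2)).
  apply: eq_bigr => y _; congr U; apply: eq_bigr => x _; by rewrite (E x).
rewrite /potential (reindex_inj (@perm_inj _ t)).
rewrite (eq_bigl (fun y => C (s y) == c :> nat)); last by move=> y; rewrite s'E.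
have eqU y : C (s y) == c :> nat -> y != i ->
    U (bigger_before c s' (t y)) (equal_after c s' (t y)) =
    U (bigger_before c s y) (equal_after c s y).
  by move=> /eqP Cy yi; rewrite bigger_before_lmove// equal_after_lmove.
have [Ci|Ci] := eqVneq (nat_of_ord (C (s i))) c; last first.
  rewrite addr0; apply: eq_bigr => y Cy; apply: eqU => //.
  by apply: contraNneq Ci => <-.
rewrite (bigD1 i) ?Ci//= [X in _ = X + _](bigD1 i) ?Ci//=.
under eq_bigr => y /andP[Cy yi] do rewrite eqU//.
rewrite equal_after_lmove// -Ci bigger_before_lmove_self /t tpermL /=; ring.
Qed.

End LeftMove.

Lemma potential_rmove s i j c U : rmove C s i = Some j ->
  potential c U (exchange s i j) = potential c U s +
  (if C (s i) == c :> nat then U (bigger_before c s i).+1 (equal_after c s i)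
                     - U (bigger_before c s i) (equal_after c s i) else 0).
Proof.
move=> /rmove_lmove mv; have := potential_lmove mv c U.
rewrite exchangeK !exchange_swap => E; rewrite [in RHS]E -addrA.
case: eqP => [Ci|_]; last by rewrite !addr0.
have := bigger_before_lmove_self mv; rewrite exchangeK !exchange_swap Ci => -> /=.
have := equal_after_lmove mv (y := j) (c := c).
rewrite exchangeK !exchange_swap tpermL => -> //.
by rewrite [X in _ + X](_ : _ = 0) ?addr0//; ring.
Qed.

Lemma eq_class_potential s s' c U : (forall x, C (s' x) = C (s x)) ->
  potential c U s' = potential c U s.
Proof.
move=> eqC; rewrite /potential; apply: eq_big => [y|y _]; first by rewrite eqC.
by congr U; apply: eq_bigr => x _; rewrite eqC.
Qed.

(** [lset] and [rset] are the removable and the addable corners of the diagram of class c. *)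
Definition lset c s : {set 'I_n} := [set i | (C (s i) == c :> nat) && isSome (lmove C s i)].
Definition rset c s : {set 'I_n} := [set i | (C (s i) == c :> nat) && isSome (rmove C s i)].
Definition rate s i : R := if rmove C s i is Some j then accept p s i j else 0.

Lemma gen_potential c U s : gen p C (potential c U) s =
  \sum_(i in lset c s) (U (bigger_before c s i).-1 (equal_after c s i)
                        - U (bigger_before c s i) (equal_after c s i)) +
  \sum_(i in rset c s) rate s i * (U (bigger_before c s i).+1 (equal_after c s i)
                        - U (bigger_before c s i) (equal_after c s i)).
Proof.
rewrite [X in X + _]big_mkcond [X in _ + X]big_mkcond -big_split.
apply: eq_bigr => i _ /=.
have -> : jumpN C (potential c U) s i = 0.
  rewrite /jumpN; case E: same_partner => [j|//].
  by rewrite (eq_class_potential _ _ (fun x => same_partner_class x E)) subrr.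
rewrite addr0 /jumpL /jumpR /rate !inE; congr (_ + _).
  case E: lmove => [j|]; last by rewrite andbF.
  by rewrite (potential_lmove E) addrAC subrr add0r andbT.
case E: rmove => [j|]; last by rewrite andbF.
rewrite (potential_rmove _ _ E) addrAC subrr add0r andbT.
by case: ifP => _; rewrite ?mulr0.
Qed.

Lemma bigger_before_lt c s x y z : (x < y)%N -> (x <= z)%N -> (z < y)%N ->
  (c < C (s z))%N -> (bigger_before c s x < bigger_before c s y)%N.
Proof.
move=> xy xz zy Cz; rewrite /bigger_before [X in (_ < X)%N](bigD1 z)//= zy Cz add1n ltnS.
rewrite (bigD1 z)//= ltnNge xz /= add0n; apply: leq_sum => u _.
by case: (ltnP u x) => //= ux; rewrite (ltn_trans ux xy).
Qed.

Lemma bigger_before_eq c s x y : (x <= y)%N ->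
  (forall z, (x <= z < y)%N -> (C (s z) <= c)%N) ->
  bigger_before c s x = bigger_before c s y.
Proof.
move=> xy none; apply: eq_bigr => u _; congr nat_of_bool.
have [ux|xu] := ltnP u x; first by rewrite (leq_trans ux xy).
by have [uy|//] := ltnP u y; have := none u; rewrite xu uy ltnNge => ->.
Qed.

Lemma equal_after_lt c s x y : (x < y)%N -> C (s y) = c :> nat ->
  (equal_after c s y < equal_after c s x)%N.
Proof.
move=> xy Cy; rewrite /equal_after [X in (_ < X)%N](bigD1 y)//= xy Cy eqxx add1n ltnS.
rewrite (bigD1 y)//= ltnn /= add0n; apply: leq_sum => u _.
by case: (ltnP y u) => //= yu; rewrite (ltn_trans xy yu).
Qed.

Lemma equal_after_next c s x y : (x < y)%N -> C (s y) = c :> nat ->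
  (forall z, (x < z < y)%N -> C (s z) != c :> nat) ->
  equal_after c s x = (equal_after c s y).+1.
Proof.
move=> xy Cy none; rewrite /equal_after (bigD1 y)//= xy Cy eqxx add1n; congr _.+1.
rewrite [RHS](bigD1 y)//= ltnn /=; apply: eq_bigr => u uy; congr nat_of_bool.
have [yu|uy'] := ltnP y u; first by rewrite (ltn_trans xy yu).
have [xu|//] := ltnP x u; rewrite (negPf (none u _)) ?xu//=.
by move: uy uy'; rewrite -val_eqE /=; lia.
Qed.

(** Between two addable corners stands the larger element that the first of them can pass. *)
Lemma rset_bigger_before_inj c s : {in rset c s &, injective (bigger_before c s)}.
Proof.
suff lt x y : x \in rset c s -> y \in rset c s -> (x < y)%N ->
    (bigger_before c s x < bigger_before c s y)%N.
  move=> x y xs ys E; apply/val_inj/eqP; rewrite eqn_leq /=.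
  by apply/andP; split; rewrite leqNgt; apply/negP => /lt; rewrite E ltnn; auto.
rewrite !inE => /andP[/eqP Cx]; case E: rmove => [j|//] _ /andP[/eqP Cy _] xy.
have /rmoveP[xj ltC bet] := E.
apply: (bigger_before_lt (z := j)) => //; rewrite ?(ltnW xj) -?Cx//.
rewrite ltnNge; apply/negP; rewrite leq_eqVlt => /orP[/eqP yj|yj].
  by move: ltC; rewrite Cx -Cy (_ : y = j) ?ltnn//; apply: val_inj.
by have := bet y; rewrite xy yj Cx Cy ltnn => /(_ isT).
Qed.

(* The leftmost element of class c behind a given number of larger elements can
   move left. *)
Lemma lset_of_bigger_before c s i : C (s i) = c :> nat -> (0 < bigger_before c s i)%N ->
  exists i', [/\ i' \in lset c s, (i' <= i)%N &
    bigger_before c s i' = bigger_before c s i].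
Proof.
move=> Ci pos; pose Q x := (C (s x) == c :> nat) && (bigger_before c s x == bigger_before c s i).
case: (@arg_minnP _ i Q val) => [|i' /andP[/eqP Ci' /eqP hi'] mn].
  by rewrite /Q Ci !eqxx.
exists i'; split=> //; last by apply: mn; rewrite /Q Ci !eqxx.
rewrite inE Ci' eqxx /=.
have [z zi' Cz] : exists2 z : 'I_n, (z < i')%N & (c < C (s z))%N.
  move: pos; rewrite -hi' lt0n sum_nat_eq0 => /forallPn[z].
  by rewrite implyTb eqb0 negbK => /andP[? ?]; exists z.
have [j E] : exists j, left_partner C s i' = Some j.
  by apply: last_before_ex zi' _; rewrite Ci' ltnW.
rewrite /lmove E; case: ifP => //; rewrite Ci' => /negbT; rewrite -leqNgt => Cj.
have /last_beforeP[ji' le bet] := E.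
have {}Cj : C (s j) = c :> nat by apply/eqP; rewrite eqn_leq Cj -{1}Ci'.
have := mn j; rewrite /Q Cj eqxx /= -hi' (bigger_before_eq (x := j) (y := i')) ?eqxx//.
- by move=> /(_ isT); rewrite leqNgt ji'.
- exact: ltnW.
- move=> u /andP[]; rewrite leq_eqVlt => /orP[/eqP /val_inj <- _|ju ui']; first by rewrite Cj.
  by have := bet u; rewrite ju ui' -ltnNge Ci' => /(_ isT)/ltnW.
Qed.

(** The next element of class c stands behind the larger element that i can pass, so it can move
    left. *)
Lemma rset_next c s i : i \in rset c s -> (0 < equal_after c s i)%N ->
  exists2 i', i' \in lset c s & equal_after c s i = (equal_after c s i').+1.
Proof.
rewrite inE => /andP[/eqP Ci]; case E: rmove => [j|//] _ pos.
have /rmoveP[ij ltC bet] := E.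
have [z] : exists z : 'I_n, (i < z)%N && (C (s z) == c :> nat).
  move: pos; rewrite lt0n sum_nat_eq0 => /forallPn[z].
  by rewrite implyTb eqb0 negbK => ?; exists z.
case/(@arg_minnP _ _ (fun z : 'I_n => (i < z)%N && (C (s z) == c :> nat)) val) => i'.
move=> /andP[ii' /eqP Ci'] mn.
have ji' : (j < i')%N.
  rewrite ltnNge leq_eqVlt; apply/negP => /orP[/eqP /val_inj i'j|i'j].
    by move: ltC; rewrite -i'j Ci Ci' ltnn.
  by have := bet i'; rewrite ii' i'j Ci Ci' ltnn => /(_ isT).
exists i'; last first.
  apply: equal_after_next => // u /andP[iu ui']; apply/negP => Cu.
  by have := mn u; rewrite iu Cu /= leqNgt ui' => /(_ isT).
rewrite inE Ci' eqxx /=.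
have [j' E'] : exists j', left_partner C s i' = Some j'.
  by apply: last_before_ex ji' _; rewrite Ci' -Ci ltnW.
rewrite /lmove E'; case: ifP => //; rewrite Ci' => /negbT; rewrite -leqNgt => Cj'.
have /last_beforeP[j'i' le bet'] := E'.
have {}Cj' : C (s j') = c :> nat by apply/eqP; rewrite eqn_leq Cj' -{1}Ci'.
have jj' : (j <= j')%N.
  rewrite leqNgt; apply/negP => j'j; have := bet' j.
  by rewrite j'j ji' Ci' -Ci (ltnW ltC) => /(_ isT).
by have := mn j'; rewrite (leq_trans ij jj') Cj' eqxx /= leqNgt j'i' => /(_ isT).
Qed.

End ClassPotentials.

(** * Drift of the potentials *)

(** Weighted form of the fact that addable corners outnumber removable ones by at most one: equal
    keys inject A into B, apart from the element of key z. *)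
Lemma ler_sum_keys (R : numDomainType) (I : finType) (A B : {set I}) (a b : I -> nat)
    (z : nat) (g : nat -> R) : (forall v, 0 <= g v) -> {in A &, injective a} ->
  (forall i, i \in A -> a i <> z -> exists2 i', i' \in B & a i = b i') ->
  \sum_(i in A) g (a i) <= g z + \sum_(i in B) g (b i).
Proof.
move=> g0 inj key; rewrite (bigID (fun i => a i == z)) /= lerD//.
  have [i0 /andP[i0A /eqP ai0]|none] := pickP (fun i => (i \in A) && (a i == z)); last first.
    by rewrite big_pred0.
  rewrite (big_pred1 i0) ?ai0// => i; apply/andP/eqP => [[iA /eqP ai]|->].
    by apply: inj; rewrite // ai ai0.
  by rewrite i0A ai0.
pose A' := [set i in A | a i != z].
pose phi i := odflt i [pick i' in B | a i == b i'].
have phiP i : i \in A' -> phi i \in B /\ a i = b (phi i).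
  rewrite inE => /andP[iA /eqP/(key _ iA)[i' i'B ai]]; rewrite /phi.
  case: pickP => [i''|none]; last by have := none i'; rewrite /= i'B ai eqxx.
  by move=> /andP[iB /eqP].
have phi_inj : {in A' &, injective phi}.
  move=> i i' /[dup] iA' /phiP[_ ai] /[dup] i'A' /phiP[_ ai'] E.
  by apply: inj; [move: iA'; rewrite inE => /andP[]
    | move: i'A'; rewrite inE => /andP[] | rewrite ai ai' E].
have -> : \sum_(i in A | a i != z) g (a i) = \sum_(i in phi @: A') g (b i).
  rewrite big_imset//=; apply: eq_big => [i|i /andP[iA az]]; first by rewrite inE.
  by have [|_ ->] := phiP i; rewrite ?inE ?iA.
rewrite [leRHS](big_setID (phi @: A')) /= (setIidPr _).
  by rewrite lerDl sumr_ge0.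
by apply/subsetP => _ /imsetP[i /phiP[iB _] ->].
Qed.

Section Profile.
Context {R : realType}.
Variables th M : R.
Hypotheses (th0 : 0 <= th) (M1 : 1 <= M).

(** The slope is small, so that neighbouring corners have almost equal weight; a far corner weighs
    M; and the cap bounds the cost of a fast right move by 2M. *)
Definition profile (v : nat) : R := Num.min (1 + th * v%:R) M.

(** The sum over the cells of row r, of length h, of the profile of the column plus the profile of
    the row. *)
Definition profile_weight (h r : nat) : R := \sum_(u < h) profile u + profile r * h%:R.

Lemma profile0 : profile 0 = 1.
Proof. by rewrite /profile mulr0 addr0; apply/min_idPl. Qed.

Lemma profile_ge1 v : 1 <= profile v.
Proof. by rewrite /profile le_min M1 lerDl mulr_ge0. Qed.

Lemma profile_leM v : profile v <= M.
Proof. by rewrite /profile ge_min lexx orbT. Qed.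

Lemma profileS v : profile v.+1 <= profile v + th.
Proof.
have M0 := lerDl M th; rewrite /profile -[v.+1]addn1 natrD mulrDr mulr1 addrA.
by rewrite addr_minl le_min !ge_min lexx M0 th0 orbT.
Qed.

Lemma profile_ltM v : profile v < M -> 1 + th * v%:R < M.
Proof. by rewrite /profile gt_min ltxx orbF. Qed.

Lemma profile_weightS h r :
  profile_weight h.+1 r - profile_weight h r = profile h + profile r.
Proof. by rewrite /profile_weight big_ord_recr /= -[h.+1]addn1 natrD; ring. Qed.

Lemma profile_weight_ge0 h r : 0 <= profile_weight h r.
Proof.
have p0 v : 0 <= profile v by apply: le_trans (profile_ge1 v).
by rewrite addr_ge0 ?sumr_ge0// mulr_ge0.
Qed.

Lemma profile_weight_le h r : profile_weight h r <= 2 * M * h%:R.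
Proof.
rewrite /profile_weight -mulrA mulr_natl mulr2n lerD//.
  rewrite mulr_natr -[in leRHS](card_ord h) -sumr_const.
  by apply: ler_sum => u _; apply: profile_leM.
by rewrite ler_wpM2r// profile_leM.
Qed.

End Profile.

Section Drift.
Context {R : realType} {n k : nat}.
Variables (gamma : R) (p : 'I_n -> 'I_n -> R) (C : 'I_n -> 'I_k).
Hypotheses (gamma_gt1 : 1 < gamma) (pP : pair_probabilities p).
Hypotheses (pC : bounded_k_class gamma p C) (wd : tk_well_defined p C).
Implicit Types (s : 'S_n) (i j m x y z u : 'I_n) (c : nat).

Definition lbelow c s : {set 'I_n} := [set i | (C (s i) < c)%N && isSome (lmove C s i)].
Definition rbelow c s : {set 'I_n} := [set i | (C (s i) < c)%N && isSome (rmove C s i)].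

Lemma card_lbelowS c s : #|lbelow c.+1 s| = (#|lbelow c s| + #|lset C c s|)%N.
Proof.
rewrite -cardsUI [X in (_ + #|pred_of_set X|)%N](_ : _ = set0) ?cards0 ?addn0.
  by apply: eq_card => i; rewrite !inE -andb_orl ltnS leq_eqVlt orbC.
by apply/setP => i; rewrite !inE; case: (ltngtP (C (s i)) c); rewrite ?andbF.
Qed.

Lemma card_rbelowS c s : #|rbelow c.+1 s| = (#|rbelow c s| + #|rset C c s|)%N.
Proof.
rewrite -cardsUI [X in (_ + #|pred_of_set X|)%N](_ : _ = set0) ?cards0 ?addn0.
  by apply: eq_card => i; rewrite !inE -andb_orl ltnS leq_eqVlt orbC.
by apply/setP => i; rewrite !inE; case: (ltngtP (C (s i)) c); rewrite ?andbF.
Qed.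

Lemma lset_bigger_before_gt0 c s i : i \in lset C c s -> (0 < bigger_before C c s i)%N.
Proof.
rewrite inE => /andP[/eqP <-]; case E: lmove => [j|//] _.
by rewrite (bigger_before_lmove_self E).
Qed.

Lemma rate_bounds s i : 0 <= rate p C s i <= 1.
Proof.
rewrite /rate; case E: rmove => [j|]; last by rewrite lexx ler01.
exact: accept_bounds E.
Qed.

Lemma rset_bigger_before_key c s i : i \in rset C c s -> bigger_before C c s i <> 0%N ->
  exists2 i', i' \in lset C c s & bigger_before C c s i = bigger_before C c s i'.
Proof.
rewrite inE => /andP[/eqP Ci _] /eqP; rewrite -lt0n => pos.
by have [i' [? _ E]] := lset_of_bigger_before Ci pos; exists i'.
Qed.

Lemma card_rset c s : (#|rset C c s| <= #|lset C c s|.+1)%N.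
Proof.
have := @ler_sum_keys rat _ (rset C c s) (lset C c s) _ _ 0%N (fun=> 1) (fun=> ler01)
  (@rset_bigger_before_inj _ _ C c s) (@rset_bigger_before_key c s).
by rewrite !sumr_const -(natrD _ 1) ler_nat.
Qed.

Lemma card_rbelow c s : (#|rbelow c s| <= #|lbelow c s| + c)%N.
Proof.
elim: c => [|c IHc]; first by rewrite eq_card0// => i; rewrite inE.
rewrite card_lbelowS card_rbelowS.
by apply: leq_trans (leq_add IHc (card_rset c s)) _; rewrite !addnS addnAC.
Qed.

(* A right move that jumps over a smaller element leaves that element, at the
   next position, with a left move; only such moves can have rate above 1/gamma. *)
Lemma card_fast_rset c s :
  (#|[set i in rset C c s | gamma^-1 < rate p C s i]%R| <= #|lbelow c s|)%N.
Proof.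
set F := [set i in _ | _].
have FP i : i \in F -> ordS i \in lbelow c s.
  rewrite 2!inE => /andP[/andP[/eqP Ci]]; rewrite /rate; case E: rmove => [j|//] _ fast.
  have [m imj] : exists m, (i < m < j)%N.
    apply/existsP; apply: contraLR fast => /existsPn none.
    by rewrite -leNgt; apply: (accept_adjacent gamma_gt1 pP pC) E none.
  have /rmoveP[ij ltC bet] := E.
  have iSj : (i.+1 < j)%N by move: imj; lia.
  have SE : ordS i = i.+1 :> nat by rewrite /= modn_small// (ltn_trans iSj).
  have CS : (C (s (ordS i)) < C (s i))%N by apply: bet; rewrite SE ltnSn iSj.
  rewrite inE -Ci CS (_ : lmove C s (ordS i) = Some i)//.
  by apply/lmoveP; split=> //; rewrite SE// => u; lia.
rewrite -(card_imset (mem F) (@ordS_inj n)); apply: subset_leq_card.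
by apply/subsetP => _ /imsetP[i iF ->]; apply: FP.
Qed.

Section ProfileDrift.
Variables (th M : R) (c : nat) (s : 'S_n).
Hypotheses (th0 : 0 < th) (M1 : 1 <= M).

Let f := profile th M.
Let h i := bigger_before C c s i.
Let r i := equal_after C c s i.
Let W := potential C c (profile_weight th M).
Let D : R := #|lset C c s|%:R.
Definition removable_weight : R := \sum_(i in lset C c s) (f (h i).-1 + f (r i)).
Let addable : R := \sum_(i in rset C c s) (f (h i) + f (r i)).

Let f0 v : 0 <= f v.
Proof. by apply: le_trans (profile_ge1 (ltW th0) M1 v). Qed.

Let gen_W : gen p C W s =
  - removable_weight + \sum_(i in rset C c s) rate p C s i * (f (h i) + f (r i)).
Proof.
rewrite gen_potential /removable_weight -sumrN; congr (_ + _); apply: eq_bigr => i iL.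
  by rewrite -(prednK (lset_bigger_before_gt0 iL)) /= -opprB profile_weightS /h.
by rewrite profile_weightS.
Qed.

(** Columns are matched between corners of equal row length, rows with the next removable corner.
    Each match shifts the profile by one step, at cost th; the possible unmatched corner of either
    kind, at coordinate 0, costs [profile 0] = 1. *)
Let addable_le : addable <= 2 + removable_weight + 2 * th * D.
Proof.
have half1 : \sum_(i in rset C c s) f (h i) <= 1 + \sum_(i in lset C c s) (f (h i).-1 + th).
  apply: le_trans (ler_sum_keys f0 (@rset_bigger_before_inj _ _ C c s)
    (@rset_bigger_before_key c s)) _.
  rewrite /f profile0// lerD2l.
  apply: ler_sum => i /lset_bigger_before_gt0 pos.
  by move: pos; rewrite /h; case: bigger_before => //= v _; apply/profileS/ltW.
have half2 : \sum_(i in rset C c s) f (r i) <= 1 + \sum_(i in lset C c s) (f (r i) + th).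
  rewrite -[X in X + _](profile0 th M1) -/f.
  apply: le_trans (ler_sum_keys (A := rset C c s) (B := lset C c s) (a := r)
    (b := fun i => (r i).+1) (z := 0%N) f0 _ _) _.
  - move=> x y; rewrite !inE => /andP[/eqP Cx _] /andP[/eqP Cy _]; rewrite /r => E.
    apply/val_inj/eqP; rewrite eqn_leq; apply/andP; split; rewrite leqNgt; apply/negP => lt.
      by have := equal_after_lt lt Cx; rewrite E ltnn.
    by have := equal_after_lt lt Cy; rewrite E ltnn.
  - by move=> i iR /eqP ri; apply: (rset_next iR); rewrite lt0n.
  by rewrite lerD2l; apply: ler_sum => i _; apply/profileS/ltW.
rewrite /addable /removable_weight !big_split /= in half1 half2 *.
move: half1 half2; rewrite !sumr_const -[th *+ _]mulr_natr -/D; lra.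
Qed.

Lemma removable_weight_ge : 2 * D <= removable_weight.
Proof.
rewrite /D -mulr_natr mulrC mulr_natl -sumr_const; apply: ler_sum => i _.
by have := profile_ge1 (ltW th0) M1 (h i).-1; have := profile_ge1 (ltW th0) M1 (r i); rewrite /f; lra.
Qed.

Lemma gen_profile_le : gen p C W s <= 2 + 2 * th * D.
Proof.
rewrite gen_W; have := addable_le; set X := \sum_(i in _) _.
suff : X <= addable by lra.
apply: ler_sum => i _; have /andP[_ r1] := rate_bounds s i.
by rewrite ler_piMl// addr_ge0.
Qed.

(** Right moves of rate at most 1/gamma are compared with the removable corners. Each faster one
    costs at most 2M and is charged by [card_fast_rset]. *)
Lemma gen_profile_le_bias : gen p C W s <=
  - (1 - gamma^-1) * removable_weight + gamma^-1 * (2 + 2 * th * D)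
  + 2 * M * #|lbelow c s|%:R.
Proof.
have q0 : 0 <= gamma^-1 by rewrite invr_ge0 ltW// (lt_trans ltr01).
rewrite gen_W; set X := \sum_(i in _) _.
suff : X <= gamma^-1 * addable + 2 * M * #|lbelow c s|%:R.
  move: addable_le; set a := addable => aL XL.
  have : gamma^-1 * a <= gamma^-1 * (2 + removable_weight + 2 * th * D) by rewrite ler_wpM2l.
  lra.
set F := [set i in rset C c s | gamma^-1 < rate p C s i]%R.
apply: (@le_trans _ _ (gamma^-1 * addable + 2 * M * #|F|%:R)); last first.
  by rewrite lerD2l ler_wpM2l ?ler_nat ?card_fast_rset// mulr_ge0// (le_trans ler01).
have -> : 2 * M * #|F|%:R = \sum_(i in rset C c s) (i \in F)%:R * (2 * M).
  rewrite mulr_natr -sumr_const big_mkcond [RHS]big_mkcond; apply: eq_bigr => i _.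
  by rewrite [i \in F]inE; case: (i \in rset C c s); case: (_ < _)%R; rewrite ?mul1r ?mul0r.
rewrite mulr_sumr -big_split; apply: ler_sum => i iR /=; rewrite inE iR /=.
have [/= fast|slow] := ltP; rewrite ?mul0r ?addr0; last by rewrite ler_wpM2r// addr_ge0.
have /andP[_ r1] := rate_bounds s i.
apply: (@le_trans _ _ (f (h i) + f (r i))); first by rewrite ler_piMl// addr_ge0.
have := profile_leM th M (h i); have := profile_leM th M (r i); rewrite -/f mul1r => ? ?.
have : 0 <= gamma^-1 * (f (h i) + f (r i)) by rewrite mulr_ge0// addr_ge0.
lra.
Qed.

End ProfileDrift.
End Drift.

(** * Inversions and a bounded penalty for unsorted words *)

Section Inversions.
Context {R : realType} {n k : nat}.
Variables (gamma : R) (p : 'I_n -> 'I_n -> R) (C : 'I_n -> 'I_k).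
Hypotheses (gamma_gt1 : 1 < gamma) (pP : pair_probabilities p).
Hypotheses (pC : bounded_k_class gamma p C) (wd : tk_well_defined p C).
Implicit Types (s : 'S_n) (i j m x y z u : 'I_n) (c : nat).

Definition inversions c s : nat :=
  \sum_(y | (C (s y) < c)%N) bigger_before C (C (s y)) s y.

Lemma inversionsS c s :
  (inversions c.+1 s)%:R = (inversions c s)%:R + potential C c (fun h _ => h%:R) s :> R.
Proof.
rewrite /inversions /potential natr_sum (bigID (fun y => C (s y) == c :> nat)) /= addrC.
rewrite natr_sum; congr (_ + _).
  by apply: eq_bigl => y; rewrite ltnS leq_eqVlt; case: eqP => [->|]; rewrite ?ltnn ?andbT.
apply: eq_big => [y|y /andP[_ /eqP->]//].
by case: eqP => [->|]; rewrite ?andbF// ltnS leqnn.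
Qed.

Lemma inversions_lmove c s i j : lmove C s i = Some j ->
  inversions c s = (inversions c (exchange s i j) + (C (s i) < c))%N.
Proof.
move=> mv; apply/eqP; rewrite -(eqr_nat R) natrD; apply/eqP.
elim: c => [|c IHc].
  by rewrite /inversions ltn0 !big_pred0 ?addr0// => y; rewrite ltn0.
rewrite !inversionsS (potential_lmove mv) IHc ltnS.
have := bigger_before_lmove_self mv.
case: (ltngtP (C (s i)) c) => [lt|lt|E] h /=; try by ring.
by rewrite -E h /= -[_.+1]addn1 natrD; ring.
Qed.

Lemma inversions_rmove c s i j : rmove C s i = Some j ->
  inversions c (exchange s i j) = (inversions c s + (C (s i) < c))%N.
Proof.
move=> /rmove_lmove /inversions_lmove E.
by rewrite (E c) exchangeK !exchange_swap.
Qed.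

Lemma eq_class_inversions c s s' : (forall x, C (s' x) = C (s x)) ->
  inversions c s' = inversions c s.
Proof.
move=> eqC; apply: eq_big => [y|y _]; rewrite eqC//.
by apply: eq_bigr => x _; rewrite eqC.
Qed.

(** Concave in the number of inversions: a left move lowers it 1/r times as much as a right move
    raises it. For small r this outweighs the at most c surplus right moves, whatever their
    rates. *)
Definition unsorted_penalty (r : R) c s : R := 1 - r ^+ inversions c s.

Lemma gen_unsorted_penalty_le r c s : 0 < r < 1 ->
  gen p C (unsorted_penalty r c) s <=
  r ^+ inversions c s * (1 - r) * (#|rbelow C c s|%:R - r^-1 * #|lbelow C c s|%:R).
Proof.
move=> /andP[r0 r1]; set N := inversions c s; set g := r ^+ N * (1 - r).
have g0 : 0 <= g by rewrite mulr_ge0 ?subr_ge0 ?exprn_ge0// ltW.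
have cardE (A : {set 'I_n}) : #|A|%:R = \sum_i (i \in A)%:R :> R.
  by rewrite -sumr_const big_mkcond; apply: eq_bigr => i _; case: (i \in A).
rewrite !cardE mulr_sumr -sumrB mulr_sumr; apply: ler_sum => i _.
have -> : jumpN C (unsorted_penalty r c) s i = 0.
  rewrite /jumpN /unsorted_penalty; case E: same_partner => [j|//].
  by rewrite (eq_class_inversions _ (fun x => same_partner_class x E)) subrr.
rewrite addr0 addrC mulrBr !inE lerD//.
  rewrite /jumpR; case E: rmove => [j|]; last by rewrite andbF mulr0.
  have /andP[a0 a1] := accept_bounds pP wd E; rewrite andbT.
  rewrite /unsorted_penalty (inversions_rmove c E) exprD -/N.
  have -> : 1 - r ^+ N * r ^+ (C (s i) < c)%N - (1 - r ^+ N) = g * (C (s i) < c)%N%:R.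
    by rewrite /g; case: (_ < c)%N; rewrite /= ?expr1 ?expr0; ring.
  by rewrite ler_piMl// mulr_ge0.
rewrite /jumpL; case E: lmove => [j|]; last by rewrite andbF !mulr0 oppr0.
rewrite andbT /unsorted_penalty /g /N (inversions_lmove c E) exprD.
case: (_ < c)%N; rewrite /= ?expr1 ?expr0 ?mulr1 ?mulr0 ?oppr0; last by rewrite subrr.
by rewrite le_eqVlt; apply/orP; left; apply/eqP; field; rewrite gt_eqF.
Qed.

Lemma gen_unsorted_penalty_sorted r c s : 0 < r < 1 -> #|lbelow C c s| = 0%N ->
  gen p C (unsorted_penalty r c) s <= c%:R.
Proof.
move=> r01 L0; apply: le_trans (gen_unsorted_penalty_le _ _ r01) _.
have := card_rbelow C c s; rewrite L0 add0n mulr0 subr0 -(ler_nat R) => le.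
have /andP[r0 r1] := r01.
have : r ^+ inversions c s * (1 - r) <= 1.
  rewrite mulr_ile1 ?exprn_ge0 ?exprn_ile1 ?subr_ge0 ?(ltW r0) ?(ltW r1)//; lra.
have : 0 <= r ^+ inversions c s * (1 - r) by rewrite mulr_ge0 ?exprn_ge0 ?subr_ge0 ?(ltW r0) ?(ltW r1).
set g := _ * _; set a := _%:R in le *; have a0 : 0 <= a by rewrite ler0n.
nra.
Qed.

Lemma gen_unsorted_penalty_unsorted c s (r := c.+2%:R^-1 : R) :
  (0 < #|lbelow C c s|)%N ->
  gen p C (unsorted_penalty r c) s <= - (2^-1 * r ^+ inversions c s).
Proof.
move=> L0; have r01 : 0 < r < 1 by rewrite invr_gt0 ltr0n invf_lt1 ?ltr1n.
apply: le_trans (gen_unsorted_penalty_le _ _ r01) _.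
have r12 : r <= 2^-1 by rewrite lef_pV2 ?posrE ?ltr0n// ler_nat.
have := card_rbelow C c s; rewrite -(ler_nat R) natrD => le.
have -> : r^-1 = c%:R + 2 by rewrite /r invrK -addn2 natrD.
move: L0; rewrite -(ler_nat R).
have /andP[/ltW r0 _] := r01; have g0 : 0 <= r ^+ inversions c s by rewrite exprn_ge0.
have c0 : 0 <= c%:R :> R by rewrite ler0n.
move: le; set a := _%:R; set l := #|lbelow C c s|%:R; set c' := c%:R.
set g := r ^+ _ => le l1.
(* From a <= l + c and l >= 1; this is why r is the inverse of c + 2. *)
have al : a - (c' + 2) * l <= - 1 by move: c0 le l1; rewrite -/c'; nra.
have : g * (1 - r) * (a - (c' + 2) * l) <= g * (1 - r) * (-1).
  by rewrite ler_wpM2l// mulr_ge0//; lra.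
have : g * r <= g * 2^-1 by rewrite ler_wpM2l.
lra.
Qed.

(* The corners of the diagram of class c span it, and the diagrams of the lower
   classes are empty. *)
Lemma inversions_le c s b : #|lbelow C c s| = 0%N ->
  (forall i, i \in lset C c s ->
     (bigger_before C c s i <= b)%N /\ (equal_after C c s i < b)%N) ->
  (inversions c.+1 s <= b * b)%N.
Proof.
move=> L0 corner.
have lower y : (C (s y) < c)%N -> bigger_before C (C (s y)) s y = 0%N.
  move=> lt; apply/eqP; rewrite -leqn0 leqNgt; apply/negP.
  move=> /(lset_of_bigger_before erefl)[i' [+ _ _]]; rewrite inE => /andP[/eqP Ci' mv].
  by have /card0_eq/(_ i') := L0; rewrite !inE Ci' lt mv.
pose Y := [set y | (C (s y) == c :> nat) && (0 < bigger_before C c s y)%N].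
have leb y : y \in Y -> (bigger_before C c s y <= b)%N.
  rewrite inE => /andP[/eqP Cy pos].
  have [i' [iL _ <-]] := lset_of_bigger_before Cy pos; by have [] := corner _ iL.
have -> : inversions c.+1 s = (\sum_(y in Y) bigger_before C c s y)%N.
  rewrite /inversions big_mkcond [RHS]big_mkcond; apply: eq_bigr => y _.
  rewrite inE ltnS; case: (ltngtP (C (s y)) c) => [lt|//|->] /=; first by rewrite lower.
  by case: posnP.
apply: (@leq_trans (#|Y| * b)%N).
  by rewrite -sum_nat_const; apply: leq_sum => y yY; apply: leb.
rewrite leq_mul2r; apply/orP; right.
(* The first nonempty row is itself a removable corner, and all other nonempty rows are counted by
   its [equal_after], so there are at most b of them. *)
have [y1 y1Y|none] := pickP (mem Y); last by rewrite eq_card0.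
case: (@arg_minnP _ y1 (mem Y) val) => // y0 y0Y mn.
have {}y0Y : y0 \in Y by [].
have /andP[/eqP Cy0 pos] : (C (s y0) == c :> nat) && (0 < bigger_before C c s y0)%N.
  by move: y0Y; rewrite inE.
have [i' [iL i'y0 hi']] := lset_of_bigger_before Cy0 pos.
have i'Y : i' \in Y by move: iL; rewrite !inE hi' pos => /andP[->].
have y0E : i' = y0 by apply/val_inj/eqP; rewrite eqn_leq i'y0 mn.
have [_ lt] := corner _ iL; apply: leq_trans lt; rewrite y0E.
rewrite (cardsD1 y0) y0Y add1n ltnS /equal_after.
rewrite -sum1_card big_mkcond; apply: leq_sum => y _.
rewrite !inE; case: eqP => //= yy0; case: eqP => //= Cy; case: posnP => //= posy.
have yY : y \in Y by rewrite inE Cy eqxx posy.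
rewrite andbT lt0b ltn_neqAle mn// andbT eq_sym; by apply/eqP => /val_inj.
Qed.

End Inversions.

Section Lyapunov.
Context {R : realType} {n k : nat}.
Variables (p : 'I_n -> 'I_n -> R) (C : 'I_n -> 'I_k).
Implicit Types (s : 'S_n) (f g : 'S_n -> R).

Lemma genD f g s : gen p C (fun s => f s + g s) s = gen p C f s + gen p C g s.
Proof.
rewrite /gen -big_split; apply: eq_bigr => i _; rewrite /jumpL /jumpR /jumpN.
by case: lmove => [?|]; case: rmove => [?|]; case: same_partner => [?|] /=; ring.
Qed.

Lemma genZ a f s : gen p C (fun s => a * f s) s = a * gen p C f s.
Proof.
rewrite /gen mulr_sumr; apply: eq_bigr => i _; rewrite /jumpL /jumpR /jumpN.
by case: lmove => [?|]; case: rmove => [?|]; case: same_partner => [?|] /=; ring.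
Qed.

Lemma bigger_before_le_n c s y : (bigger_before C c s y <= n)%N.
Proof.
rewrite -[leqRHS]card_ord -sum1_card; apply: leq_sum => x _; exact: leq_b1.
Qed.

Lemma potential_bounds (th M : R) c s : 0 <= th -> 1 <= M ->
  0 <= potential C c (profile_weight th M) s <= 2 * M * n%:R ^+ 2.
Proof.
move=> th0 M1; rewrite sumr_ge0 /=; last by move=> y _; apply: profile_weight_ge0.
rewrite /potential big_mkcond.
apply: (@le_trans _ _ (\sum_(y < n) 2 * M * n%:R)); last first.
  by rewrite sumr_const card_ord -[_ *+ n]mulr_natr -[leLHS]mulrA expr2.
have b0 : 0 <= 2 * M * n%:R by rewrite mulr_ge0// mulr_ge0// (le_trans ler01).
apply: ler_sum => y _; case: ifP => // _.
apply: le_trans (profile_weight_le th M _ _) _.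
by rewrite ler_wpM2l ?ler_nat ?bigger_before_le_n// mulr_ge0// (le_trans ler01).
Qed.

End Lyapunov.

(* The slope th of the profile is small compared with the bias 1 - q. So W
   decreases when the lower classes are sorted and the diagram of class c is not
   tiny, and in general it grows at most in proportion to the number of left
   moves of the lower classes, which a multiple of their potential absorbs. The
   penalty G deals with tiny diagrams. *)
Lemma lyapunov (R : realType) (k : nat) (gamma : R) (gamma_gt1 : 1 < gamma) (c : nat) :
  exists eta beta B : R, [/\ 0 < eta, 0 <= beta, 0 <= B &
    forall (n : nat) (p : 'I_n -> 'I_n -> R) (C : 'I_n -> 'I_k),
      (0 < n)%N -> pair_probabilities p -> bounded_k_class gamma p C ->
      tk_well_defined p C ->
      exists V : 'S_n -> R, (forall s, 0 <= V s <= B * n%:R ^+ 2) /\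
        forall s, gen p C V s <= - eta * #|lbelow C c s|%:R
                                + beta * (#|lbelow C c s| == 0)%N%:R].
Proof.
elim: c => [|c [eta [beta [B [eta0 beta0 B0 IHc]]]]].
  exists 1, 0, 0; split=> // n p C _ _ _ _; exists (fun=> 0); split=> s.
    by rewrite mul0r lexx.
  rewrite (_ : lbelow C 0 s = set0); last by apply/setP => i; rewrite !inE.
  rewrite cards0 mulr0 mul0r addr0.
    by rewrite /gen big1 ?mulr0// => i _; rewrite /jumpL /jumpR /jumpN; case: lmove => [?|];
      case: rmove => [?|]; case: same_partner => [?|]; rewrite ?subrr ?mulr0 ?addr0.
pose q := gamma^-1; pose e := 1 - q.
have q0 : 0 < q by rewrite invr_gt0 (lt_trans ltr01).
have e0 : 0 < e by rewrite subr_gt0 invf_lt1 ?(lt_trans ltr01).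
have e1 : e < 1 by rewrite /e; lra.
(* [C1] is the growth on sorted lower classes inherited from the previous potential. Both a
   removable weight of at least [M] and the penalty at no more than b^2 inversions have to beat
   [C1 + 2], which fixes [M] and [K]. A corner coordinate of profile below [M] is below [b]. *)
pose C1 := 6 / eta * beta.
have C10 : 0 <= C1 by rewrite mulr_ge0// divr_ge0// ltW.
pose M := 2 * (C1 + 2) / e.
have eM : e * M = 2 * (C1 + 2) by rewrite /M mulrC divfK ?gt_eqF.
have M1 : 4 < M by nra.
pose th := e / (4 * M).
have thM : M * th = e / 4 by rewrite /th; field; rewrite gt_eqF//; lra.
have th0 : 0 < th by rewrite divr_gt0//; lra.
have the : th <= e / 4 by nra.
pose b := (Num.trunc (M / th)).+1.
have Mb : M < th * b%:R.
  by rewrite mulrC -ltr_pdivrMr// truncnS_gt.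
pose r : R := c.+3%:R^-1.
have r0 : 0 < r by rewrite invr_gt0 ltr0n.
pose K := 2 * (C1 + 2) / r ^+ (b * b).
have rb0 : 0 < r ^+ (b * b) by rewrite exprn_gt0.
have KE : K * r ^+ (b * b) = 2 * (C1 + 2) by rewrite /K divfK ?gt_eqF.
have K0 : 0 < K by rewrite divr_gt0//; lra.
have r01 : 0 < r < 1 by rewrite r0 invf_lt1 ?ltr0n ?ltr1n.
clearbody M th b K.
exists th, (C1 + 2 + K * c.+1%:R), (6 / eta * B + 2 * M + K).
have Kc0 : 0 <= K * c.+1%:R by rewrite mulr_ge0// ltW.
have eB0 : 0 <= 6 / eta * B by rewrite mulr_ge0// divr_ge0// ltW.
split=> //; [by lra | by lra |] => n p C n0 pP pC wd.
have [V [Vb drift]] := IHc n p C n0 pP pC wd.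
pose W := potential C c (profile_weight th M).
pose G := unsorted_penalty C r c.+1.
exists (fun s => 6 / eta * V s + (W s + K * G s)); split=> s.
  have /andP[V0 VB] := Vb s.
  have /andP[W0 WM] : 0 <= W s <= 2 * M * n%:R ^+ 2.
    by apply: potential_bounds; [exact: ltW | lra].
  have /andP[G0 G1] : 0 <= G s <= 1.
    rewrite /G /unsorted_penalty subr_ge0 exprn_ile1 ?(ltW r0)//=; last by case/andP: r01 => _ /ltW.
    by rewrite gerBl exprn_ge0// ltW.
  have n1 : 1 <= n%:R ^+ 2 :> R by rewrite exprn_ege1// ler1n.
  have A0 : 0 <= 6 / eta * V s by rewrite mulr_ge0// divr_ge0// ltW.
  have AB : 6 / eta * V s <= 6 / eta * (B * n%:R ^+ 2) by rewrite ler_wpM2l// divr_ge0// ltW.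
  have KG0 : 0 <= K * G s by rewrite mulr_ge0// ltW.
  have KG : K * G s <= K * n%:R ^+ 2.
    by rewrite ler_wpM2l ?(ltW K0)// (le_trans G1).
  by rewrite !mulrDl -mulrA; apply/andP; split; lra.
rewrite genD genZ genD genZ card_lbelowS natrD.
set D := #|lset C c s|; set L := #|lbelow C c s|.
have genV : 6 / eta * gen p C V s <= - 6 * L%:R + C1 * (L == 0)%N%:R.
  have := ler_wpM2l (divr_ge0 (ler0n R 6) (ltW eta0)) (drift s); rewrite -/L.
  by congr (_ <= _); rewrite /C1; field; rewrite gt_eqF.
have genW := gen_profile_le pP wd c s th0 (ltW (lt_trans (ltr1n R 4 : 1 < 4) M1)).
have genWb := gen_profile_le_bias gamma_gt1 pP pC wd c s th0 (ltW (lt_trans (ltr1n R 4 : 1 < 4) M1)).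
have Rge := removable_weight_ge C c s th0 (ltW (lt_trans (ltr1n R 4 : 1 < 4) M1)).
move: genW genWb Rge; rewrite -/W -/D -/L -/q -/e.
set Rs := removable_weight _ _ _ _ _; set gW := gen p C W s => genW genWb Rge.
have D0 : 0 <= D%:R :> R by rewrite ler0n.
have thD : th * D%:R <= e / 4 * D%:R by rewrite ler_wpM2r.
have thD0 : 0 <= th * D%:R by rewrite mulr_ge0// ltW.
have genG : (0 < L + D)%N -> K * gen p C G s <= - (2^-1 * (K * r ^+ inversions C c.+1 s)).
  move=> pos; rewrite mulrCA -mulrN ler_wpM2l ?(ltW K0)//.
  by apply: gen_unsorted_penalty_unsorted => //; rewrite card_lbelowS.
have KrN : 0 <= K * r ^+ inversions C c.+1 s by rewrite mulr_ge0 ?exprn_ge0 ?ltW.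
have qle : q * (2 + 2 * th * D%:R) <= 2 + 2 * (th * D%:R).
  by rewrite -mulrA ler_piMl//; [lra | rewrite /e in e0; lra].
(* When lower classes are unsorted, the drift -6L of the scaled potential pays 5L for the growth of
   [W] and L for the new drift. If th D exceeds L, the bias on class c covers the fast moves as
   well. *)
have [L0|Lpos] := posnP L; last first.
  have L1 : 1 <= L%:R :> R by rewrite ler1n.
  have {}genG := genG (ltn_addr _ Lpos).
  rewrite addn_eq0 gtn_eqF//= mulr0 addr0.
  rewrite gtn_eqF//= mulr0 addr0 in genV.
  have thL : th * L%:R <= L%:R by rewrite ler_piMl//; lra.
  suff : gW <= - (th * D%:R) + 5 * L%:R by move: (_ * gen p C G s) genG => *; lra.
  have [le|lt] := leP (th * D%:R) L%:R; first by lra.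
  have : M * L%:R <= e / 4 * D%:R by rewrite -thM -mulrA ler_wpM2l ?ltW//; lra.
  have : e * (2 * D%:R) <= e * Rs by rewrite ler_wpM2l// ltW.
  lra.
rewrite L0 eqxx mulr0 add0r mulr1 in genV *.
rewrite L0 mulr0 addr0 in genWb; rewrite L0 add0n in genG.
rewrite add0r.
have [Dz|Dpos] := posnP D.
  have := gen_unsorted_penalty_sorted pP wd (s := s) (c := c.+1) r01.
  rewrite card_lbelowS -/L -/D L0 Dz => /(_ erefl) sorted.
  have : K * gen p C G s <= K * c.+1%:R by rewrite ler_wpM2l// ltW.
  by rewrite Dz in genW *; rewrite ?addn0 ?eqxx /=; lra.
have {}genG := genG Dpos.
have D1 : 1 <= D%:R :> R by rewrite ler1n.
rewrite /= mulr0 addr0.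
have eRs : e * (2 * D%:R) <= e * Rs by rewrite ler_wpM2l// ltW.
have {}genWb : gW <= - (e * Rs) / 2 + 2 - th * D%:R by lra.
(* A large diagram is handled by the bias; in a small one all corners have coordinates bounded by b,
   so inversions are few and the penalty is effective. *)
have [MRs|RsM] := leP M Rs.
  have : e * M <= e * Rs by rewrite ler_wpM2l// ltW.
  lra.
have Ninv : (inversions C c.+1 s <= b * b)%N.
  apply: inversions_le => // i iL.
  have f0 v : 0 <= profile th M v by apply: le_trans (profile_ge1 (ltW th0) _ v); lra.
  have le1 : profile th M (bigger_before C c s i).-1 + profile th M (equal_after C c s i) <= Rs.
    by rewrite /Rs /removable_weight (bigD1 i)//= lerDl sumr_ge0// => j _; rewrite addr_ge0.
  have small v : profile th M v <= Rs -> (v < b)%N.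
    move=> le; have /profile_ltM lt := le_lt_trans le RsM.
    by rewrite -(ltr_nat R) -(ltr_pM2l th0); lra.
  have h0 := f0 (bigger_before C c s i).-1; have r0' := f0 (equal_after C c s i).
  split; last by apply: small; lra.
  by apply: leq_trans (leqSpred _) _; apply: small; lra.
have : K * r ^+ (b * b) <= K * r ^+ inversions C c.+1 s.
  rewrite ler_wpM2l ?(ltW K0)//; apply: ler_wiXn2l => //; first exact: ltW.
  by case/andP: r01 => _ /ltW.
have : 0 <= e * Rs by lra.
lra.
Qed.

(** * Mixing inside the classes *)

Section LabelMixing.
Context {R : realType} {n k : nat}.
Variables (gamma : R) (p : 'I_n -> 'I_n -> R) (C : 'I_n -> 'I_k).
Hypotheses (gamma_gt1 : 1 < gamma) (pP : pair_probabilities p).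
Hypotheses (pC : bounded_k_class gamma p C) (wd : tk_well_defined p C).
Hypothesis n_gt0 : (0 < n)%N.
Implicit Types (s g : 'S_n) (i j x y z : 'I_n) (f F : 'S_n -> R).

Let P := tk_kernel p C.

Lemma avg_relabel g f s : (forall x, C (g x) = C x) ->
  avg P (fun s => f (s * g)%g) s = avg P f (s * g)%g.
Proof. by move=> gC; rewrite !avg_tk// (gen_relabel pP pC). Qed.

Lemma iter_avg_relabel g f t s : (forall x, C (g x) = C x) ->
  iter t (avg P) (fun s => f (s * g)%g) s = iter t (avg P) f (s * g)%g.
Proof.
move=> gC; elim: t s => //= t IHt s.
by rewrite -(avg_relabel _ _ gC); apply: eq_avg.
Qed.

(** The place of label z inside its class, counted from the right. *)
Definition rank s z : nat := equal_after C (C z) s ((s^-1)%g z).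

Lemma rank_lt_n s z : (rank s z < n)%N.
Proof.
rewrite /rank /equal_after (bigD1 ((s^-1)%g z))//= ltnn add0n.
rewrite -[ltnRHS]card_ord (cardD1 ((s^-1)%g z)) inE add1n ltnS -sum1_card.
rewrite [leqRHS]big_mkcond [leqLHS]big_mkcond; apply: leq_sum => x _.
by rewrite !inE andbT; case: (x == _) => //=; exact: leq_b1.
Qed.

Lemma exchange_inv s i j z : ((exchange s i j)^-1)%g z = tperm i j ((s^-1)%g z).
Proof. by rewrite /exchange invMg tpermV permM. Qed.

Lemma rank_lmove s i j z : lmove C s i = Some j -> rank (exchange s i j) z = rank s z.
Proof.
by move=> mv; rewrite /rank exchange_inv equal_after_lmove// permKV.
Qed.

Lemma rank_rmove s i j z : rmove C s i = Some j -> rank (exchange s i j) z = rank s z.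
Proof. by move=> /rmove_lmove/(rank_lmove z); rewrite exchangeK. Qed.

Lemma eq_class_equal_after s s' c y : (forall x, C (s' x) = C (s x)) ->
  equal_after C c s' y = equal_after C c s y.
Proof. by move=> eqC; apply: eq_bigr => x _; rewrite eqC. Qed.

Lemma rank_same s i j z : same_partner C s i = Some j -> z != s i -> z != s j ->
  rank (exchange s i j) z = rank s z.
Proof.
move=> mv zi zj; rewrite /rank exchange_inv tpermD.
- by apply: eq_class_equal_after => x; apply: same_partner_class.
- by apply: contraNneq zi => ->; rewrite permKV.
- by apply: contraNneq zj => ->; rewrite permKV.
Qed.

Lemma rank_same_self s i j : same_partner C s i = Some j ->
  [/\ rank s (s j) = (rank s (s i)).+1,
      rank (exchange s i j) (s i) = (rank s (s i)).+1 &
      rank (exchange s i j) (s j) = rank s (s i)].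
Proof.
move=> mv; have /same_partnerP[ji Cj bet] := mv.
have eqC x := same_partner_class x mv.
have next : equal_after C (C (s i)) s j = (equal_after C (C (s i)) s i).+1.
  apply: equal_after_next => // z /bet ne.
  by apply/eqP => E; apply: ne; apply: val_inj.
rewrite /rank !exchange_inv !permK tpermL tpermR !(eq_class_equal_after _ _ eqC) Cj.
by split.
Qed.

Lemma rank_lt s y z : C y = C z -> (((s^-1)%g y < (s^-1)%g z) = (rank s z < rank s y))%N.
Proof.
have lt u v : C u = C v -> ((s^-1)%g u < (s^-1)%g v)%N -> (rank s v < rank s u)%N.
  by move=> E uv; rewrite /rank E equal_after_lt// permKV.
move=> E; have [yz|zy|/val_inj/perm_inj->] := ltngtP ((s^-1)%g y) ((s^-1)%g z).
- by rewrite lt.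
- by rewrite ltnNge ltnW// lt.
- by rewrite ltnn.
Qed.

Lemma rank_inj s y z : C y = C z -> rank s y = rank s z -> y = z.
Proof.
move=> E r; have := rank_lt s E; have := rank_lt s (esym E); rewrite r ltnn => yz zy.
by apply: (@perm_inj _ (s^-1)%g); apply: val_inj; move: yz zy => /=; lia.
Qed.


Lemma same_partner_inj s i i' j :
  same_partner C s i = Some j -> same_partner C s i' = Some j -> i = i'.
Proof.
move=> mv mv'; have /same_partnerP[_ Cj _] := mv; have /same_partnerP[_ Cj' _] := mv'.
have [E _ _] := rank_same_self mv; have [E' _ _] := rank_same_self mv'.
apply: (@perm_inj _ s); apply: (rank_inj (s := s)); first by rewrite -Cj.
by apply/succn_inj; rewrite -E.
Qed.

Lemma same_partner_rank s y : (exists2 z, C z = C y & (rank s y < rank s z)%N) ->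
  exists2 j, same_partner C s ((s^-1)%g y) = Some j & C (s j) = C y.
Proof.
move=> [z Cz zy]; have lt : ((s^-1)%g z < (s^-1)%g y)%N by rewrite rank_lt.
have [j E] : exists j, same_partner C s ((s^-1)%g y) = Some j.
  by apply: last_before_ex lt _; rewrite !permKV Cz.
by exists j => //; have /same_partnerP[_ ->] := E; rewrite permKV.
Qed.

Lemma rank_pred s y z : C z = C y -> (rank s y < rank s z)%N ->
  exists2 i, same_partner C s i = Some ((s^-1)%g z) & C (s i) = C z.
Proof.
move=> Cz yz; have lt : ((s^-1)%g z < (s^-1)%g y)%N by rewrite rank_lt.
pose Q i := ((s^-1)%g z < i)%N && (C (s i) == C z).
have Qy : Q ((s^-1)%g y) by rewrite /Q lt permKV Cz eqxx.
case: (arg_minnP val Qy) => i /andP[zi /eqP Ci] mn; exists i => //.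
apply/same_partnerP; split; rewrite ?permKV// => m /andP[zm mi] Cm.
by have := mn m; rewrite /Q zm Cm Ci eqxx leqNgt mi => /(_ isT).
Qed.

Lemma same_partner_first s y :
  exists2 i, same_partner C s i = None & C (s i) = C y.
Proof.
pose Q i := C (s i) == C y; have Qy : Q ((s^-1)%g y) by rewrite /Q permKV.
case: (arg_minnP val Qy) => i /eqP Ci mn; exists i => //.
case E: same_partner => [j|//]; have /same_partnerP[ji Cj _] := E.
by have := mn j; rewrite /Q Cj Ci eqxx leqNgt ji => /(_ isT).
Qed.

(** The concave function with second difference -2 that vanishes at 0 and increases up to d = n. *)
Definition gap_weight (d : nat) : R := d%:R * (2 * n%:R - d%:R).

Lemma gap_weight_le d : gap_weight d <= n%:R ^+ 2.
Proof. by rewrite /gap_weight; have := sqr_ge0 (n%:R - d%:R : R); set x := n%:R; nra. Qed.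

Lemma gap_weightS_le d : (d < n)%N -> gap_weight d <= gap_weight d.+1.
Proof.
by rewrite -(ler_nat R) /gap_weight -![d.+1]addn1 natrD => ?; nra.
Qed.

Lemma gap_weight_ge1 d : (0 < d < n)%N -> 1 <= gap_weight d.
Proof.
move=> /andP[]; rewrite -(ler_nat R) -(ltr_nat R) /gap_weight => ? ?; nra.
Qed.

Lemma gap_weight_concave d :
  gap_weight d.+2 + gap_weight d - 2 * gap_weight d.+1 = - 2.
Proof. by rewrite /gap_weight -[d.+2]addn2 -[d.+1]addn1 !natrD; ring. Qed.

Section Pair.
Variables (a b : 'I_n) (F : 'S_n -> R) (B : R).
Hypotheses (ab : a != b) (Cab : C a = C b).
Hypothesis antisym : forall s, F (s * tperm a b)%g = - F s.

Definition gap s : nat := (rank s a - rank s b) + (rank s b - rank s a).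

Hypotheses (B0 : 0 <= B) (FB : forall s, `|F s| <= B * gap_weight (gap s)).

(* The swap of a and b, available when their ranks are adjacent, contributes
   - F s, which cancels the contribution F s of the idle move of the first
   element of the class. *)
Lemma sum_jumpN_antisym s : (rank s a < rank s b)%N ->
  `|\sum_i (F s + jumpN C F s i)| <= B * (n%:R * gap_weight (gap s) - 4).
Proof.
move=> lt; set d := gap s.
have dE : d = (rank s b - rank s a)%N by rewrite /d /gap; lia.
have d0 : (0 < d)%N by rewrite dE subn_gt0.
have dn : (d < n)%N by have := rank_lt_n s b; rewrite dE; lia.
pose ia := (s^-1)%g a; pose ib := (s^-1)%g b.
have sia : s ia = a by rewrite permKV.
have sib : s ib = b by rewrite permKV.
have iab : ia != ib by rewrite (inj_eq perm_inj).
pose up := gap_weight d.+1 - gap_weight d.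
have up0 : 0 <= up by rewrite subr_ge0 gap_weightS_le.
(* At most two moves widen the gap: b exchanging with the label of next higher rank, or a with that
   of next lower rank. *)
pose bump i : R := (i == ib)%:R * up + (same_partner C s i == Some ia)%:R * up.
have bump0 i : 0 <= bump i by rewrite addr_ge0// mulr_ge0.
have sum_bump : \sum_i bump i <= 2 * up.
  rewrite big_split /= -!mulr_suml -mulrDl ler_wpM2r//.
  have -> : 2 = 1 + 1 :> R by ring.
  rewrite lerD//; first by rewrite (bigD1 ib)//= eqxx big1 ?addr0// => i /negPf->.
  have [i0 /eqP E0|none] := pickP (fun i => same_partner C s i == Some ia).
    rewrite (bigD1 i0)//= E0 eqxx big1 ?addr0// => i ii0; case: eqP => // E.
    by move: ii0; rewrite (same_partner_inj E E0) eqxx.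
  by rewrite big1 ?ler01// => i _; rewrite none.
pose v i : R := F s + jumpN C F s i.
have vle i : i != ia -> same_partner C s i != Some ib ->
    `|v i| <= B * (gap_weight d + bump i).
  move=> iia ib'; rewrite /v /jumpN; case E: same_partner ib' => [j|] ib'; last first.
    rewrite addr0; apply: le_trans (FB s) _; rewrite ler_wpM2l// lerDl; exact: bump0.
  have jib : j != ib by apply: contraNneq ib' => ->.
  rewrite addrC subrK; apply: le_trans (FB _) _; rewrite ler_wpM2l//.
  have [rj ri' rj'] := rank_same_self E.
  have sia' : s i != a by rewrite -sia (inj_eq perm_inj).
  have sjb : s j != b by rewrite -sib (inj_eq perm_inj).
  have upE : gap_weight d.+1 = gap_weight d + up by rewrite /up; ring.
  rewrite /bump E; have [ibE|inb] := eqVneq i ib.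
    have -> : gap (exchange s i j) = d.+1.
      have rb : rank (exchange s i j) b = (rank s b).+1 by move: rj ri'; rewrite ibE sib.
      have ra : rank (exchange s i j) a = rank s a.
        apply: (rank_same E); first by rewrite eq_sym.
        apply: contraTneq lt => aj; move: rj; rewrite -aj ibE sib => ->; clear; lia.
      by rewrite /gap ra rb dE; move: lt; clear; lia.
    by rewrite mul1r upE lerD2l lerDl mulr_ge0.
  have sib' : s i != b by rewrite -sib (inj_eq perm_inj).
  rewrite mul0r add0r; have [jia|jia] := eqVneq j ia.
    have -> : gap (exchange s i j) = d.+1.
      have ra : (rank (exchange s i j) a).+1 = rank s a.
        by move: rj rj'; rewrite jia sia => -> ->.
      have rb : rank (exchange s i j) b = rank s b.
        by apply: (rank_same E); rewrite eq_sym.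
      by rewrite /gap rb dE; move: lt; rewrite -ra; clear; lia.
    by rewrite jia eqxx mul1r upE.
  have -> : (Some j == Some ia) = false by apply/negP => /eqP[/eqP]; rewrite (negPf jia).
  rewrite mul0r addr0.
  have sja : s j != a by rewrite -sia (inj_eq perm_inj).
  by rewrite /d /gap !(rank_same E)// eq_sym.
have [ja Eja Cja] : exists2 j, same_partner C s ia = Some j & C (s j) = C a.
  by apply: same_partner_rank; exists b.
have [nb Enb Cnb] := rank_pred (esym Cab) lt.
have [ranka _ _] := rank_same_self Eja; rewrite sia in ranka.
have [rankb _ _] := rank_same_self Enb; rewrite -/ib sib in rankb.
pose g := gap_weight d.
(* The gain comes from two moves, estimated together by [X]: those that narrow the gap, or the
   cancelling pair when a and b are neighbours. In both cases concavity yields the -4. *)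
have two_terms i X : i != ia -> `|v ia + v i| <= B * X ->
    (forall i', i' != ia -> i' != i -> same_partner C s i' != Some ib) ->
    X + 2 * up - 2 * g <= - 4 -> `|\sum_i v i| <= B * (n%:R * g - 4).
  move=> iia vX rest XE.
  rewrite (bigD1 ia)//= (bigD1 i)//= addrA; apply: le_trans (ler_normD _ _) _.
  apply: (@le_trans _ _ (B * (X + n%:R * g + 2 * up - 2 * g))); last first.
    by rewrite ler_wpM2l//; lra.
  have total : \sum_i (g + bump i) <= n%:R * g + 2 * up.
    by rewrite big_split /= sumr_const card_ord -[g *+ n]mulr_natl lerD2l.
  rewrite (bigD1 ia)//= (bigD1 i)//= in total.
  have rest_le : `|\sum_(i' | (i' != ia) && (i' != i)) v i'| <=
      B * \sum_(i' | (i' != ia) && (i' != i)) (g + bump i').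
    rewrite mulr_sumr; apply: le_trans (ler_norm_sum _ _ _) _.
    by apply: ler_sum => i' /andP[i'a i'i]; apply: vle => //; apply: rest.
  apply: le_trans (lerD vX rest_le) _; rewrite -mulrDr ler_wpM2l//.
  by have := bump0 ia; have := bump0 i; lra.
have g0 : gap_weight 0 = 0 by rewrite /gap_weight mul0r.
have [adj|nadj] := eqVneq (rank s b) (rank s a).+1.
  have d1 : d = 1%N by rewrite dE adj; lia.
  have sja : s ja = b by apply: (rank_inj (s := s)); rewrite ?Cja// ranka adj.
  have jab : ja = ib by apply: (@perm_inj _ s); rewrite sja sib.
  rewrite {}jab in Eja.
  have [i0 E0 _] := same_partner_first s a.
  have i0a : i0 != ia by apply: contra_eqN E0 => /eqP->; rewrite Eja.
  apply: (two_terms i0 0) => //.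
  - rewrite /v /jumpN Eja E0 (_ : exchange s ia ib = (s * tperm a b)%g).
      by rewrite antisym mulr0 addr0 normr_le0; apply/eqP; ring.
    by rewrite /exchange conjgC tpermJ sia sib.
  - move=> i' i'a _; apply: contraNneq i'a => E; exact/eqP/(same_partner_inj E Eja).
  - by have := gap_weight_concave 0; rewrite /up /g d1 g0; lra.
have nba : nb != ia.
  by apply: contraNneq nadj => E; move: rankb; rewrite E sia => ->.
apply: (two_terms nb (2 * gap_weight d.-1)) => //.
- apply: le_trans (ler_normD _ _) _; rewrite mulrCA mulr_natl mulr2n; apply: lerD.
    rewrite /v /jumpN Eja addrC subrK; apply: le_trans (FB _) _; rewrite ler_wpM2l//.
    have [_ ra _] := rank_same_self Eja; rewrite sia in ra.
    have rb : rank (exchange s ia ja) b = rank s b.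
      apply: (rank_same Eja); first by rewrite sia eq_sym.
      by apply: contra_neqN nadj => /eqP bE; rewrite -ranka -bE.
    by rewrite /gap ra rb (_ : (_ + _)%N = d.-1)// dE; move: lt; clear; lia.
  rewrite /v /jumpN Enb addrC subrK; apply: le_trans (FB _) _; rewrite ler_wpM2l//.
  have [_ _ rb] := rank_same_self Enb; rewrite -/ib sib in rb.
  have ra : rank (exchange s nb ib) a = rank s a.
    apply: (rank_same Enb); last by rewrite sib.
    by apply: contra_neqN nadj => /eqP aE; rewrite rankb -aE.
  by rewrite /gap ra rb (_ : (_ + _)%N = d.-1)// dE rankb; move: lt; rewrite rankb; clear; lia.
- move=> i' _ i'nb; apply: contraNneq i'nb => E; exact/eqP/(same_partner_inj E Enb).
- by have := gap_weight_concave d.-1; rewrite /up /g prednK//; lra.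
Qed.

End Pair.

Lemma gapC a b s : gap b a s = gap a b s.
Proof. by rewrite /gap addnC. Qed.

(** Left and right moves preserve ranks, so only moves inside the classes contract. They gain 4 out
    of 3 n g, and g <= n^2 makes this the relative rate 4 / (3 n^3). *)
Lemma avg_antisym a b F B : a != b -> C a = C b ->
  (forall s, F (s * tperm a b)%g = - F s) -> 0 <= B ->
  (forall s, `|F s| <= B * gap_weight (gap a b s)) ->
  forall s, `|avg P F s| <= B * (1 - 4 / (3 * n%:R ^+ 3)) * gap_weight (gap a b s).
Proof.
move=> ab Cab antisym B0 FB s; set g := gap_weight _.
have sumN : `|\sum_i (F s + jumpN C F s i)| <= B * (n%:R * g - 4).
  have [lt|lt|E] := ltngtP (rank s a) (rank s b).
  - exact: sum_jumpN_antisym.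
  - rewrite /g -gapC; apply: sum_jumpN_antisym => //; first by rewrite eq_sym.
      by move=> s'; rewrite tpermC antisym.
    by move=> s'; rewrite gapC.
  - by move: ab; rewrite (rank_inj Cab E) eqxx.
have cstE : B * (n%:R * g) = \sum_(i < n) B * g.
  by rewrite sumr_const card_ord mulrCA mulr_natl.
have sumL : `|\sum_i (F s + jumpL C F s i)| <= B * (n%:R * g).
  rewrite cstE; apply: le_trans (ler_norm_sum _ _ _) _.
  apply: ler_sum => i _; rewrite /jumpL; case E: lmove => [j|]; last by rewrite addr0.
  by rewrite addrC subrK; apply: le_trans (FB _) _; rewrite /gap !(rank_lmove _ E).
have sumR : `|\sum_i (F s + jumpR p C F s i)| <= B * (n%:R * g).
  rewrite cstE; apply: le_trans (ler_norm_sum _ _ _) _.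
  apply: ler_sum => i _; rewrite /jumpR; case E: rmove => [j|]; last by rewrite addr0.
  have /andP[a0 a1] := accept_bounds pP wd E; set acc := accept _ _ _ _ in a0 a1 *.
  have -> : F s + acc * (F (exchange s i j) - F s) = (1 - acc) * F s + acc * F (exchange s i j).
    by ring.
  have acc0 : 0 <= 1 - acc by rewrite subr_ge0.
  apply: le_trans (ler_normD _ _) _; rewrite !normrM (ger0_norm a0) (ger0_norm acc0).
  have le2 : `|F (exchange s i j)| <= B * g.
    by apply: le_trans (FB _) _; rewrite /g /gap !(rank_rmove _ E).
  apply: le_trans (lerD (ler_wpM2l acc0 (FB s)) (ler_wpM2l a0 le2)) _.
  by rewrite -mulrDl subrK mul1r.
have n0 : 0 < n%:R :> R by rewrite ltr0n.
have -> : avg P F s = (3 * n%:R)^-1 * (\sum_i (F s + jumpL C F s i)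
    + \sum_i (F s + jumpR p C F s i) + \sum_i (F s + jumpN C F s i)).
  rewrite avg_tk// natrM mulrC [n%:R * 3]mulrC /gen !big_split /= !sumr_const !card_ord.
  by rewrite -[_ *+ n]mulr_natl; field; rewrite gt_eqF.
rewrite normrM ger0_norm ?invr_ge0 ?mulr_ge0 ?ler0n//.
rewrite mulrC ler_pdivrMr ?mulr_gt0//.
apply: le_trans (ler_normD _ _) _.
apply: le_trans (lerD (le_trans (ler_normD _ _) (lerD sumL sumR)) sumN) _.
have gn : g <= n%:R ^+ 2 := gap_weight_le _.
have -> : B * (1 - 4 / (3 * n%:R ^+ 3)) * g * (3 * n%:R) =
    B * (3 * n%:R * g - 4 * (g / n%:R ^+ 2)) by field; rewrite gt_eqF.
have -> : B * (n%:R * g) + B * (n%:R * g) + B * (n%:R * g - 4) = B * (3 * n%:R * g - 4) by ring.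
rewrite ler_wpM2l//.
have : g / n%:R ^+ 2 <= 1 by rewrite ler_pdivrMr ?exprn_gt0// mul1r.
lra.
Qed.

Definition label_rate : R := 1 - 4 / (3 * n%:R ^+ 3).

(** Relabelling commutes with P, so the difference stays antisymmetric and [avg_antisym] can be
    iterated. Initially it is at most 1, hence at most [gap_weight], as the two ranks differ. *)
Lemma iter_avg_transposition a b f t s : a != b -> C a = C b ->
  (forall s, 0 <= f s <= 1) -> 0 <= label_rate ->
  `|iter t (avg P) f (s * tperm a b)%g - iter t (avg P) f s| <=
  label_rate ^+ t * n%:R ^+ 2.
Proof.
move=> ab Cab f01 rate0; pose F s := f (s * tperm a b)%g + -1 * f s.
have tC x : C (tperm a b x) = C x by case: tpermP => // ->.
have tK s' : (s' * tperm a b * tperm a b)%g = s' by rewrite -mulgA tperm2 mulg1.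
have iterF u s' : iter u (avg P) F s' =
    iter u (avg P) f (s' * tperm a b)%g - iter u (avg P) f s'.
  rewrite /F (iter_avgD _ _ (fun s => f (s * tperm a b)%g)) iter_avgZ iter_avg_relabel//.
  by rewrite mulN1r.
have bound u s' : `|iter u (avg P) F s'| <= label_rate ^+ u * gap_weight (gap a b s').
  elim: u s' => [|u IHu] s'.
    rewrite expr0 mul1r /= /F.
    apply: (@le_trans _ _ 1).
      have := f01 s'; have := f01 (s' * tperm a b)%g.
      by rewrite ler_norml; move=> /andP[? ?] /andP[? ?]; apply/andP; split; lra.
    apply: gap_weight_ge1; rewrite /gap.
    have := rank_lt_n s' a; have := rank_lt_n s' b.
    have : rank s' a <> rank s' b by move=> /(rank_inj Cab) /eqP; rewrite (negPf ab).
    lia.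
  rewrite iterS exprSr; apply: avg_antisym => //; last by rewrite exprn_ge0.
  by move=> s2; rewrite !iterF tK opprB.
rewrite -iterF; apply: le_trans (bound t s) _.
by rewrite ler_wpM2l ?exprn_ge0// gap_weight_le.
Qed.

Lemma iter_avg_label f t s g : (forall x, C (g x) = C x) ->
  (forall s, 0 <= f s <= 1) -> 0 <= label_rate ->
  `|iter t (avg P) f (s * g)%g - iter t (avg P) f s| <= label_rate ^+ t * n%:R ^+ 3.
Proof.
move=> gC f01 rate0; pose moved (g : 'S_n) := [set x | g x != x].
have [m le_m] : exists m, (#|moved g| <= m)%N by exists #|moved g|.
have bound : `|iter t (avg P) f (s * g)%g - iter t (avg P) f s| <=
    #|moved g|%:R * (label_rate ^+ t * n%:R ^+ 2).
  elim: m g gC le_m => [|m IHm] g gC le_m; have [x gx|fix_g] := pickP (fun x => g x != x).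
  - by move: le_m; rewrite (cardsD1 x) inE gx.
  - have -> : g = 1%g by apply/permP => x; rewrite perm1; apply/eqP/negbFE/fix_g.
    by rewrite mulg1 subrr normr0 mulr_ge0// mulr_ge0 ?exprn_ge0.
  (* Composing with this transposition fixes x and moves no new point. *)
  - pose t' := tperm x (g x); pose g' := (g * t')%g.
    have g'x : g' x = x by rewrite /g' permM tpermR.
    have tC y : C (t' y) = C y by rewrite /t'; case: tpermP => // ->; rewrite gC.
    have g'C y : C (g' y) = C y by rewrite permM tC gC.
    have sub : moved g' \subset moved g :\ x.
      apply/subsetP => y; rewrite !inE => g'y.
      have yx : y != x by apply: contraNneq g'y => ->; rewrite g'x.
      rewrite yx /=; apply: contraNneq g'y => gy; rewrite /g' permM gy /t' tpermD// 1?eq_sym//.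
      by apply: contraNneq yx => E; apply/eqP/(@perm_inj _ g); rewrite gy.
    have lt : (#|moved g'| < #|moved g|)%N.
      by rewrite [X in (_ < X)%N](cardsD1 x) inE gx add1n ltnS; apply: subset_leq_card.
    have gE : g = (g' * t')%g by rewrite /g' -mulgA tperm2 mulg1.
    rewrite {1}gE mulgA.
    have := IHm g' g'C (leq_trans lt le_m).
    have := @iter_avg_transposition x (g x) f t (s * g')%g.
    rewrite eq_sym gx gC => /(_ isT erefl f01 rate0).
    rewrite -/t'; set u := iter _ _ _ _; set v := iter _ _ _ (s * g')%g; set w := iter _ _ _ s.
    move=> uv vw; apply: le_trans (ler_distD v _ _) _.
    apply: le_trans (lerD uv vw) _.
    have : #|moved g'|.+1%:R * (label_rate ^+ t * n%:R ^+ 2) <=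
        #|moved g|%:R * (label_rate ^+ t * n%:R ^+ 2).
      by rewrite ler_wpM2r ?ler_nat// mulr_ge0 ?exprn_ge0.
    by rewrite -addn1 natrD; lra.
  - have -> : g = 1%g by apply/permP => x; rewrite perm1; apply/eqP/negbFE/fix_g.
    by rewrite mulg1 subrr normr0 mulr_ge0// mulr_ge0 ?exprn_ge0.
apply: le_trans bound _; rewrite [leRHS](_ : _ = n%:R * (label_rate ^+ t * n%:R ^+ 2)); last by ring.
by rewrite ler_wpM2r ?mulr_ge0 ?exprn_ge0// ler_nat -[leqRHS]card_ord max_card.
Qed.

End LabelMixing.

(** * Mixing of the word of classes *)

Section SortedStates.
Context {n k : nat}.
Variable C : 'I_n -> 'I_k.
Implicit Types (s g : 'S_n) (i j x : 'I_n).

Definition class_sorted : {set 'S_n} := [set s | #|lbelow C k s| == 0%N].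

Lemma class_sorted_lmove s i : s \in class_sorted -> lmove C s i = None.
Proof.
rewrite inE => /eqP/card0_eq/(_ i); rewrite !inE ltn_ord.
by case: lmove.
Qed.

(** Take the leftmost element behind j of smaller class. Having no left move, it has a left partner
    of its own class, which would be an earlier such element. *)
Lemma class_sorted_mono s i j : s \in class_sorted -> (j < i)%N -> (C (s j) <= C (s i))%N.
Proof.
move=> sO ji; rewrite leqNgt; apply/negP => lt.
pose Q i := (j < i)%N && (C (s i) < C (s j))%N.
have Qi : Q i by rewrite /Q ji lt.
case: (arg_minnP val Qi) => i' /andP[ji' lt'] mn.
have [j' E] : exists j', left_partner C s i' = Some j'.
  by apply: last_before_ex ji' _; apply: ltnW.
have /last_beforeP[j'i' le bet] := E.
have := class_sorted_lmove i' sO; rewrite /lmove E; case: ltnP => // ge _.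
have Cj' : C (s j') = C (s i') :> nat by apply/eqP; rewrite eqn_leq ge.
have : ~~ Q j' by apply: contraL j'i' => /mn; rewrite -leqNgt.
rewrite /Q Cj' lt' andbT -leqNgt leq_eqVlt => /orP[/eqP/val_inj j'j|j'j].
  by move: lt'; rewrite -Cj' j'j ltnn.
by have := bet j; rewrite j'j ji' (ltnW lt') => /(_ isT).
Qed.

Lemma class_sorted_eq s s' : s \in class_sorted -> s' \in class_sorted ->
  forall x, C (s x) = C (s' x).
Proof.
move=> sO s'O x; apply: val_inj => /=; move: x.
have srt u : u \in class_sorted -> sorted leq [seq nat_of_ord (C (u i)) | i <- enum 'I_n].
  move=> uO; have : sorted (fun i j : 'I_n => i < j)%N (enum 'I_n).
    have := iota_ltn_sorted 0 n; rewrite -val_enum_ord sorted_map.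
    by apply: sub_sorted.
  by apply: homo_sorted => i j; apply: class_sorted_mono.
have perm (u : 'S_n) : perm_eq [seq nat_of_ord (C (u i)) | i <- enum 'I_n]
                      [seq nat_of_ord (C i) | i <- enum 'I_n].
  rewrite (map_comp (fun i => nat_of_ord (C i)) u); apply: perm_map.
  apply: uniq_perm; [by rewrite (map_inj_uniq (@perm_inj _ u)) enum_uniq | exact: enum_uniq |].
  move=> y; rewrite mem_enum inE; apply/mapP; exists ((u^-1)%g y); rewrite ?mem_enum//.
  by rewrite permKV.
have E := sorted_eq leq_trans anti_leq (srt s sO) (srt s' s'O).
have /eq_in_map F : [seq nat_of_ord (C (s i)) | i <- enum 'I_n] =
    [seq nat_of_ord (C (s' i)) | i <- enum 'I_n].
  by apply: E; rewrite (perm_trans (perm s))// perm_sym.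
by move=> x; apply: F; rewrite mem_enum.
Qed.

Lemma class_sorted_relabel s s' : s \in class_sorted -> s' \in class_sorted ->
  exists2 g : 'S_n, (forall x, C (g x) = C x) & s' = (s * g)%g.
Proof.
move=> sO s'O; exists (s^-1 * s')%g; last by rewrite mulKVg.
move=> x; rewrite permM -(class_sorted_eq sO s'O) permKV//.
Qed.

Lemma mem_class_sorted_relabel s g : (forall x, C (g x) = C x) ->
  ((s * g)%g \in class_sorted) = (s \in class_sorted).
Proof.
move=> gC; rewrite !inE; congr (_ == _); apply: eq_card => i; rewrite !inE.
by rewrite permM gC (@eq_class_lmove _ _ C s)// => x; rewrite permM gC.
Qed.

End SortedStates.

Section Doeblin.
Context {R : realType} {n k : nat}.
Variables (gamma : R) (p : 'I_n -> 'I_n -> R) (C : 'I_n -> 'I_k).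
Hypotheses (gamma_gt1 : 1 < gamma) (pP : pair_probabilities p).
Hypotheses (pC : bounded_k_class gamma p C) (wd : tk_well_defined p C).
Hypothesis n_gt0 : (0 < n)%N.
Implicit Types (s g : 'S_n) (f : 'S_n -> R).

Let P := tk_kernel p C.
Let O := class_sorted C.
Let stochP : stochastic P := tk_stochastic pP wd n_gt0.

Variables (eta beta B : R) (V : 'S_n -> R).
Hypotheses (eta_gt0 : 0 < eta) (beta_ge0 : 0 <= beta) (B_ge0 : 0 <= B).
Hypothesis V_bounds : forall s, 0 <= V s <= B * n%:R ^+ 2.
Hypothesis drift : forall s, gen p C V s <=
  - eta * #|lbelow C k s|%:R + beta * (#|lbelow C k s| == 0)%N%:R.

(** The solution m of beta m = eta (1 - m): under pi the mean of [gen V] is 0. *)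
Definition sorted_mass : R := eta / (eta + beta).

Lemma sorted_mass_bounds : 0 < sorted_mass <= 1.
Proof.
have eb : 0 < eta + beta by rewrite ltr_pwDl.
by rewrite divr_gt0//= ler_pdivrMr// mul1r lerDl.
Qed.

Lemma perm_pi_sorted_ge : sorted_mass <= \sum_(s in O) perm_pi p s.
Proof.
set m := \sum_(s in O) _.
have pi0 := perm_pi_ge0 gamma_gt1 pP pC; have pi1 := perm_pi_sum1 gamma_gt1 pP pC.
have stat := iter_avg_stationary stochP (tk_reversible pP pC wd) 1 V.
have gen0 : \sum_s perm_pi p s * gen p C V s = 0.
  have n30 : (n * 3)%:R != 0 :> R by rewrite pnatr_eq0 -lt0n muln_gt0 n_gt0.
  move: stat => /= /eqP; rewrite -subr_eq0 -sumrB => /eqP stat.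
  apply: (mulfI (invr_neq0 n30)); rewrite mulr0 -[RHS]stat mulr_sumr.
  by apply: eq_bigr => s _; rewrite avg_tk//; ring.
have outE : \sum_(s | s \notin O) perm_pi p s = 1 - m.
  by rewrite -pi1 /m [X in _ = X - _](bigID (mem O)) /= addrAC subrr add0r.
have : \sum_s perm_pi p s * gen p C V s <= beta * m - eta * (1 - m).
  rewrite (bigID (mem O)) /= -outE /m !mulr_sumr -sumrN lerD//; apply: ler_sum => s sO.
    rewrite mulrC ler_wpM2r ?pi0//; apply: le_trans (drift s) _.
    by move: sO; rewrite inE => /eqP->; rewrite eqxx mulr0 mulr1 add0r.
  rewrite mulrC -mulNr ler_wpM2r ?pi0//; apply: le_trans (drift s) _.
  move: sO; rewrite inE => ne; rewrite (negPf ne) mulr0 addr0.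
  move: ne; rewrite -lt0n -(ler_nat R) => ne.
  by rewrite mulNr lerN2 ler_peMr// ltW.
have := beta_ge0; have := eta_gt0; rewrite gen0 /sorted_mass => ? ? ?.
by rewrite ler_pdivrMr; lra.
Qed.

Lemma occupation_relabel t s g : (forall x, C (g x) = C x) ->
  occupation P O t (s * g)%g = occupation P O t s.
Proof.
move=> gC; rewrite /occupation -(iter_avg_relabel pP pC n_gt0 _ _ _ gC).
by apply: eq_iter_avg => s'; rewrite mem_class_sorted_relabel.
Qed.

(** All left choices are idle in a sorted state, so it is kept with probability at least 1/3. This
    passes from even to odd times. *)
Lemma avg_sorted_ge f s : (forall s, 0 <= f s) -> s \in O -> f s / 3 <= avg P f s.
Proof.
move=> f0 sO; rewrite avg_tk//.
have n0 : 0 < n%:R :> R by rewrite ltr0n.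
have -> : f s + (n * 3)%:R^-1 * gen p C f s = (n * 3)%:R^-1 * \sum_(i < n)
    (f s + (f s + jumpR p C f s i) + (f s + jumpN C f s i)).
  have -> : \sum_(i < n) (f s + (f s + jumpR p C f s i) + (f s + jumpN C f s i)) =
      \sum_(i < n) 3 * f s + gen p C f s.
    rewrite -big_split; apply: eq_bigr => i _ /=.
    by rewrite /jumpL (class_sorted_lmove i sO); ring.
  rewrite sumr_const card_ord -[_ *+ n]mulr_natl natrM.
  by field; rewrite gt_eqF.
have -> : f s / 3 = (n * 3)%:R^-1 * \sum_(i < n) f s.
  by rewrite sumr_const card_ord -[_ *+ n]mulr_natl natrM; field; rewrite gt_eqF.
rewrite ler_wpM2l ?invr_ge0//; apply: ler_sum => i _.
rewrite -addrA lerDl addr_ge0//.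
  rewrite /jumpR; case E: rmove => [j|]; last by rewrite addr0.
  have /andP[a0 a1] := accept_bounds pP wd E; set a := accept _ _ _ _ in a0 a1 *.
  have -> : f s + a * (f (exchange s i j) - f s) = (1 - a) * f s + a * f (exchange s i j) by ring.
  by rewrite addr_ge0// mulr_ge0// subr_ge0.
by rewrite /jumpN; case: same_partner => [j|]; rewrite ?addr0// addrC subrK.
Qed.

Lemma occupation_sorted_ge t s : s \in O -> sorted_mass / 3 <= occupation P O t s.
Proof.
move=> sO; have /andP[m0 m1] := sorted_mass_bounds.
have even u s' : s' \in O -> sorted_mass <= occupation P O (u + u) s'.
  move=> s'O; have piO := perm_pi_sorted_ge.
  have := return_mass_ge stochP (perm_pi_ge0 gamma_gt1 pP pC)
    (perm_pi_sum1 gamma_gt1 pP pC) (tk_reversible pP pC wd) O u.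
  (* Occupation is constant on the orbit O, so one factor pi(O) cancels in the averaged return
     bound. *)
  rewrite [leRHS](eq_bigr (fun s => perm_pi p s * occupation P O (u + u) s')); last first.
    move=> s2 s2O; have [g gC ->] := class_sorted_relabel s'O s2O.
    by congr (_ * _); apply: occupation_relabel.
  rewrite -[leRHS]mulr_suml expr2 ler_pM2l; first exact: le_trans.
  exact: lt_le_trans piO.
have occ0 u s' : 0 <= occupation P O u s'.
  pose h s2 : R := (s2 \in O)%:R; have b01 s2 : 0 <= h s2 <= 1 by rewrite /h; case: (s2 \in O); rewrite /= lexx ler01.
  by have /andP[] := iter_avg_bounds stochP u b01 s'.
rewrite -(odd_double_half t) -addnn; case: (odd t); rewrite /= ?add0n ?add1n.
  apply: le_trans (avg_sorted_ge (occ0 _) sO); rewrite ler_pM2r ?invr_gt0//.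
  exact: even.
by apply: le_trans (even _ _ sO); lra.
Qed.

(** The drift per step is eta / (3n) and V is at most B n^2, so this T makes survival at most
    1/2. *)
Lemma occupation_ge_everywhere T : 6 * B * n%:R ^+ 3 <= eta * T%:R -> (0 < T)%N ->
  forall s, sorted_mass / 6 <= occupation P O T s.
Proof.
move=> TB T0 s; have /andP[m0 m1] := sorted_mass_bounds.
have n0 : 0 < n%:R :> R by rewrite ltr0n.
have n30 : 0 < (n * 3)%:R :> R by rewrite ltr0n muln_gt0 n_gt0.
have step s' : s' \notin O -> avg P V s' + eta / (n * 3)%:R <= V s'.
  move=> s'O; rewrite avg_tk// -addrA gerDl addrC -[_ / _]mulrC -mulrDr.
  rewrite pmulr_rle0 ?invr_gt0//; have := drift s'.
  move: s'O; rewrite inE => ne; rewrite (negPf ne) mulr0 addr0.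
  move: ne; rewrite -lt0n -(ler_nat R) => L1.
  have : eta * 1 <= eta * #|lbelow C k s'|%:R by rewrite ler_wpM2l// ltW.
  by rewrite mulNr; lra.
have V0 s' : 0 <= V s' by have /andP[] := V_bounds s'.
have eta0 : 0 <= eta / (n * 3)%:R by rewrite divr_ge0// ltW.
have := survival_lyapunov stochP V0 step eta0 T s.
have /andP[s0 _] := survival_bounds stochP O T s.
have /andP[_ VB] := V_bounds s; move=> /le_trans/(_ VB).
rewrite [X in X <= _](_ : _ = (eta * T%:R) * survival P O T s / (n * 3)%:R); last by ring.
rewrite ler_pdivrMr// => le.
have half : survival P O T s <= 2^-1.
  rewrite leNgt; apply/negP => gt.
  have T1 : 0 < eta * T%:R by rewrite mulr_gt0// ltr0n.
  have : eta * T%:R * 2^-1 < eta * T%:R * survival P O T s by rewrite ltr_pM2l.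
  by move: le TB; rewrite natrM !exprS expr0 mulr1; lra.
have := occupation_ge stochP T s (divr_ge0 (ltW m0) (ler0n R 3)) occupation_sorted_ge.
apply: le_trans.
have : sorted_mass / 3 * 2^-1 <= sorted_mass / 3 * (1 - survival P O T s).
  by apply: ler_wpM2l; [rewrite divr_ge0// ltW | move: half; lra].
by apply: le_trans; lra.
Qed.

Hypothesis n_gt1 : (1 < n)%N.

(** For n = 1 the rate would be -1/3. *)
Lemma label_rate_bounds : 0 <= @label_rate R n <= 1.
Proof.
have n3 : 8 <= n%:R ^+ 3 :> R.
  have : 2 <= n%:R :> R by rewrite ler_nat.
  by set x := n%:R => x2; rewrite !exprS expr0 mulr1; nra.
rewrite /label_rate subr_ge0 gerBl divr_ge0 ?mulr_ge0 ?exprn_ge0// andbT.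
rewrite ler_pdivrMr; lra.
Qed.

(** D / e, with D the label error after t0 steps, is the fixed point of u -> (1 - e) u + D; later
    blocks only shrink the label error. *)
Lemma iter_avg_osc T t0 m f : (0 < T)%N -> 6 * B * n%:R ^+ 3 <= eta * T%:R ->
  (forall s, 0 <= f s <= 1) ->
  let e := (sorted_mass / 6) ^+ 2 in
  forall s s', iter (T * m + t0) (avg P) f s - iter (T * m + t0) (avg P) f s' <=
    (1 - e) ^+ m + @label_rate R n ^+ t0 * n%:R ^+ 3 / e.
Proof.
move=> T0 TB f01 e; have /andP[m0 m1] := sorted_mass_bounds.
have e0 : 0 < e by rewrite exprn_gt0// divr_gt0.
have e1 : e <= 1 by apply: exprn_ile1; [rewrite divr_ge0// ltW | lra].
have /andP[r0 r1] := label_rate_bounds.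
set D := _ * n%:R ^+ 3; have D0 : 0 <= D by rewrite mulr_ge0 ?exprn_ge0.
elim: m => [|m IHm] s s'.
  have /andP[_ fs] := iter_avg_bounds stochP (T * 0 + t0) f01 s.
  have /andP[fs' _] := iter_avg_bounds stochP (T * 0 + t0) f01 s'.
  by have : 0 <= D / e by [rewrite divr_ge0// ltW]; rewrite expr0; lra.
rewrite mulnS -addnA iterD.
apply: le_trans (iter_avg_contraction (O := O) (e := sorted_mass / 6) (d := D) stochP _ _ _ IHm _ D0 s s') _.
- by rewrite divr_ge0// ltW.
- by rewrite addr_ge0 ?exprn_ge0 ?subr_ge0// divr_ge0// ltW.
- exact: occupation_ge_everywhere.
- move=> x y xO yO; have [g gC ->] := class_sorted_relabel yO xO.
  apply: le_trans (ler_norm _) _.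
  apply: le_trans (iter_avg_label gamma_gt1 pP pC wd n_gt0 _ _ gC f01 r0) _.
  rewrite ler_wpM2r ?exprn_ge0//; apply: ler_wiXn2l => //; exact: leq_addl.
rewrite -/e exprS mulrDr -addrA lerD2l.
rewrite le_eqVlt; apply/orP; left; apply/eqP; field.
by rewrite gt_eqF.
Qed.

End Doeblin.

(** * Existence of the mixing time and the final estimate *)

Lemma exp_decay_le (R : realType) (x y : R) (t : nat) :
  0 <= x <= 1 -> 0 < y -> ln y^-1 <= x * t%:R -> (1 - x) ^+ t <= y.
Proof.
move=> /andP[x0 x1] y0; rewrite lnV ?posrE// => le.
have le1 : 1 - x <= expR (- x) by apply: expR_ge1Dx.
apply: (@le_trans _ _ (expR (- x) ^+ t)); first by apply: lerXn2r; rewrite ?nnegrE ?subr_ge0 ?expR_ge0.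
by rewrite -expRM_natl -[leRHS](lnK (x := y)) ?posrE// ler_expR; lra.
Qed.

Lemma trunc_bounds (R : realType) (x : R) : 0 <= x ->
  x <= (Num.trunc x).+1%:R <= x + 1.
Proof.
by move=> x0; rewrite ltW ?truncnS_gt//= -addn1 natrD lerD2r truncn_le.
Qed.

(** Beyond t nothing needs checking, so [mixed] becomes a decidable condition on the times below t
    and a minimum exists. *)
Lemma mixing_time_exists (R : realType) (S : finType) (P : S -> S -> R) (pi : S -> R)
    (eps : R) (t : nat) :
  mixed P pi eps t -> exists2 tau, is_mixing_time P pi eps tau & (tau <= t)%N.
Proof.
move=> mt; pose Q u := [forall v : 'I_t, (u <= v)%N ==> (worst_tv P pi v <= eps)].
have Qt : Q t by apply/forallP => v; rewrite leqNgt ltn_ord.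
have mixedE u : mixed P pi eps u -> Q u.
  by move=> mu; apply/forallP => v; apply/implyP => uv; apply: mu.
case: (ex_minnP (ex_intro Q t Qt)) => tau Qtau mn; exists tau; last exact: mn.
split; last by move=> u /mixedE/mn.
move=> v tv; have [vt|] := ltnP v t; last exact: mt.
by have /forallP/(_ (Ordinal vt))/implyP := Qtau; apply.
Qed.

Lemma worst_tv_le (R : realType) (S : finType) (P : S -> S -> R) (pi : S -> R)
    (eps : R) (t : nat) : 0 <= eps ->
  (forall x, tv_dist (iter_kernel P t x) pi <= eps) -> worst_tv P pi t <= eps.
Proof.
move=> e0 le; apply: (big_ind (fun z => z <= eps)) => // x y xe ye.
by rewrite ge_max xe ye.
Qed.

Lemma interval_classes_size (n k : nat) (C : 'I_n -> 'I_k) d :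
  interval_classes d C -> (k <= n)%N.
Proof.
move=> [d0 dk dS _]; suff le c : (c <= k)%N -> (c <= d c)%N by rewrite -dk; apply: le.
elim: c => // c IHc ck; exact: leq_ltn_trans (IHc (ltnW ck)) (dS _ ck).
Qed.

Theorem theorem2 (R : realType) (k : nat) (gamma : R)
    (k_ge2 : (2 <= k)%N) (gamma_gt1 : 1 < gamma) :
  exists2 K : R, 0 < K &
    forall (n : nat) (p : 'I_n -> 'I_n -> R) (C : 'I_n -> 'I_k) (eps : R),
      pair_probabilities p ->
      weakly_monotonic p ->
      bounded_k_class gamma p C ->
      tk_well_defined p C ->
      0 < eps < 1 ->
      exists2 tau : nat,
        is_mixing_time (tk_kernel p C) (perm_pi p) eps tau &
        tau%:R <= K * n%:R ^+ (2 * k) * ln (k%:R / eps).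
Proof.
have [eta [beta [B [eta0 beta0 B0 lyap]]]] := lyapunov k gamma_gt1 k.
have /andP[m0 m1] := sorted_mass_bounds eta0 beta0.
pose e := (sorted_mass eta beta / 6) ^+ 2.
have e0 : 0 < e by rewrite exprn_gt0// divr_gt0.
have e1 : e <= 1 by apply: exprn_ile1; [rewrite divr_ge0// ltW | lra].
have eE : e = (sorted_mass eta beta / 6) ^+ 2 by []; clearbody e.
(* As k >= 2 and eps < 1, ln(k / eps) is at least ln 2; dividing by [l] absorbs additive constants
   and roundings. *)
pose l : R := ln 2; have l0 : 0 < l by rewrite ln_gt0// ltr1n.
pose le : R := ln e^-1; have le0 : 0 <= le by rewrite ln_ge0// invf_ge1.
pose c1 := 6 * B / eta + 1; pose c2 := e^-1 + l^-1; pose c3 := 1 + 3 / l + le / l.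
have c10 : 0 < c1 by rewrite ltr_wpDl// divr_ge0 ?mulr_ge0// ltW.
have c20 : 0 < c2 by rewrite addr_gt0 ?invr_gt0.
have c30 : 0 < c3 by rewrite /c3 -addrA ltr_pwDl// addr_ge0 ?divr_ge0// ltW.
exists (c1 * c2 + c3 + l^-1).
  by rewrite addr_gt0 ?invr_gt0// addr_gt0// mulr_gt0.
move=> n p C eps pP _ pC wd /andP[eps0 eps1].
have n2 : (2 <= n)%N.
  by case: pC => -[[d dC] _ _] _; apply: leq_trans k_ge2 (interval_classes_size dC).
have n0 : (0 < n)%N by apply: ltn_trans n2.
have [V [Vb drift]] := lyap n p C n0 pP pC wd.
pose N : R := n%:R; have N1 : 1 <= N by rewrite ler1n.
have N0 : 0 < N by apply: lt_le_trans N1.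
have N30 : 0 < N ^+ 3 by rewrite exprn_gt0// (lt_le_trans ltr01).
pose L := ln (k%:R / eps).
have L2 : ln (2 / eps) <= L.
  by rewrite ler_ln ?posrE ?divr_gt0 ?ltr0n// ?(ltn_trans _ k_ge2)// ler_pM2r ?invr_gt0// ler_nat.
have lL2 : l <= ln (2 / eps).
  by rewrite ler_ln ?posrE ?divr_gt0// ler_pdivlMr// ler_piMr// ltW.
have L0 : 0 < L by rewrite (lt_le_trans l0)// (le_trans lL2).
(* [T] is the block length, [m] blocks reduce the first error to eps / 2, and [y] is the value of
   [label_rate ^+ t0] at which the second error is eps / 2. *)
pose T := (Num.trunc (6 * B * N ^+ 3 / eta)).+1.
pose m := (Num.trunc (ln (2 / eps) / e)).+1.
pose y := eps * e / (2 * N ^+ 3).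
have y0 : 0 < y by apply: divr_gt0; apply: mulr_gt0.
pose t0 := (Num.trunc (3 * N ^+ 3 / 4 * ln y^-1)).+1.
have lnN : ln (N ^+ 3) <= 3 * N.
  by rewrite lnXn// -[ln N *+ 3]mulr_natl ler_wpM2l// ltW// ln_sublinear.
have lny : ln y^-1 = ln (2 / eps) + ln (N ^+ 3) + le.
  have -> : y^-1 = 2 / eps * N ^+ 3 * e^-1 by rewrite /y; field; rewrite !gt_eqF//.
  have pe : 0 < 2 / eps by apply: divr_gt0.
  by rewrite !lnM ?posrE ?invr_gt0// mulr_gt0.
have lnN0 : 0 <= ln (N ^+ 3) by rewrite ln_ge0// exprn_ege1.
have lny0 : 0 <= ln y^-1 by lra.
have /andP[T1 T2] : 6 * B * N ^+ 3 / eta <= T%:R <= 6 * B * N ^+ 3 / eta + 1.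
  by apply: trunc_bounds; rewrite divr_ge0 ?mulr_ge0 ?(ltW eta0) ?(ltW N30).
have /andP[mle mge] : ln (2 / eps) / e <= m%:R <= ln (2 / eps) / e + 1.
  by apply: trunc_bounds; rewrite divr_ge0// ?(ltW e0)//; lra.
have /andP[t1 t2] : 3 * N ^+ 3 / 4 * ln y^-1 <= t0%:R <= 3 * N ^+ 3 / 4 * ln y^-1 + 1.
  by apply: trunc_bounds; rewrite mulr_ge0// divr_ge0// mulr_ge0// ltW.
have mt : mixed (tk_kernel p C) (perm_pi p) eps (T * m + t0).
  move=> t' /subnK <-; rewrite addnC; set u := (t' - _)%N.
  apply: worst_tv_le => [|x]; first exact: ltW.
  apply: (tv_dist_le (tk_stochastic pP wd n0) (perm_pi_ge0 gamma_gt1 pP pC)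
    (perm_pi_sum1 gamma_gt1 pP pC) (tk_reversible pP pC wd)) => f f01 s s'.
  rewrite iterD.
  have f01' := iter_avg_bounds (tk_stochastic pP wd n0) u f01.
  have TB : 6 * B * n%:R ^+ 3 <= eta * T%:R.
    by rewrite -/N [leRHS]mulrC -ler_pdivrMr.
  apply: le_trans (iter_avg_osc gamma_gt1 pP pC wd n0 eta0 beta0 Vb drift n2
    t0 m (ltn0Sn _) TB f01' s s') _.
  have d1 : (1 - e) ^+ m <= eps / 2.
    apply: exp_decay_le; [by rewrite (ltW e0) | by rewrite divr_gt0 |].
    by rewrite invf_div [leRHS]mulrC -ler_pdivrMr.
  have d2 : @label_rate R n ^+ t0 <= y.
    rewrite /label_rate -/N; apply: exp_decay_le => //.
      have := @label_rate_bounds R n n2; rewrite /label_rate -/N subr_ge0 => /andP[-> _].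
      by rewrite divr_ge0 ?mulr_ge0// ltW.
    have -> : 4 / (3 * N ^+ 3) * t0%:R = t0%:R / (3 * N ^+ 3 / 4).
      by field; rewrite gt_eqF.
    rewrite ler_pdivlMr; last by apply: divr_gt0 => //; apply: mulr_gt0.
    by rewrite mulrC.
  have : @label_rate R n ^+ t0 * n%:R ^+ 3 / e <= y * N ^+ 3 / e.
    by rewrite ler_wpM2r ?invr_ge0 ?(ltW e0)// ler_wpM2r// ltW.
  have -> : y * N ^+ 3 / e = eps / 2 by rewrite /y; field; rewrite !gt_eqF//.
  by rewrite -eE; lra.
have [tau tauP tau_le] := mixing_time_exists mt; exists tau => //.
apply: (@le_trans _ _ (T * m + t0)%:R); first by rewrite ler_nat.
have N4 : N ^+ 4 <= N ^+ (2 * k) by rewrite ler_weXn2l// (leq_mul2l 2 2).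
apply: (@le_trans _ _ ((c1 * c2 + c3 + l^-1) * N ^+ 4 * L)); last first.
  rewrite ler_wpM2r ?(ltW L0)// ler_wpM2l// ltW//.
  by rewrite addr_gt0 ?invr_gt0// addr_gt0// mulr_gt0.
have N31 : 1 <= N ^+ 3 by rewrite exprn_ege1.
have N34 : N ^+ 3 <= N ^+ 4 by rewrite ler_weXn2l.
have lL : 1 <= L / l by rewrite ler_pdivlMr// mul1r (le_trans lL2).
have T3 : T%:R <= c1 * N ^+ 3.
  by apply: le_trans T2 _; rewrite /c1 mulrDl mul1r -mulrA mulrAC; lra.
have m3 : m%:R <= c2 * L.
  have h1 : ln (2 / eps) / e <= e^-1 * L.
    by rewrite mulrC ler_wpM2l ?invr_ge0 ?(ltW e0).
  by apply: le_trans mge _; rewrite /c2 [leRHS]mulrDl lerD// mulrC.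
have lny2 : ln y^-1 <= c3 * (N * L).
  have NL : l <= N * L.
    by apply: le_trans (le_trans lL2 L2) _; rewrite ler_peMl// ltW.
  have h1 : L <= N * L by rewrite ler_peMl// ltW.
  have h2 : 3 * N <= 3 / l * (N * L).
    have : 3 * N * 1 <= 3 * N * (L / l) by rewrite ler_wpM2l// mulr_ge0//; lra.
    lra.
  have h3 : le <= le / l * (N * L).
    have : le / l * l <= le / l * (N * L) by rewrite ler_wpM2l// divr_ge0// ltW.
    by rewrite divfK ?gt_eqF.
  by rewrite lny /c3; lra.
have t3 : t0%:R <= c3 * (N ^+ 4 * L) + l^-1 * (N ^+ 4 * L).
  have h1 : 3 * N ^+ 3 / 4 * ln y^-1 <= N ^+ 3 * (c3 * (N * L)).
    have : N ^+ 3 * ln y^-1 <= N ^+ 3 * (c3 * (N * L)) by rewrite ler_wpM2l// ltW.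
    have : 0 <= N ^+ 3 * ln y^-1 by rewrite mulr_ge0// ltW.
    lra.
  have h2 : 1 <= l^-1 * (N ^+ 4 * L).
    have : 1 * (L / l) <= N ^+ 4 * (L / l).
      by rewrite ler_wpM2r ?divr_ge0 ?(ltW L0) ?(ltW l0)// exprn_ege1.
    lra.
  have -> : c3 * (N ^+ 4 * L) = N ^+ 3 * (c3 * (N * L)) by rewrite [N ^+ 4]exprS; ring.
  lra.
have Tm : T%:R * m%:R <= c1 * c2 * (N ^+ 4 * L).
  apply: le_trans (ler_pM _ _ T3 m3) _ => //.
  have -> : c1 * N ^+ 3 * (c2 * L) = c1 * c2 * (N ^+ 3 * L) by ring.
  by rewrite ler_wpM2l ?mulr_ge0 ?(ltW c10) ?(ltW c20)// ler_wpM2r// ltW.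
rewrite natrD natrM; lra.
Qed.
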